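(* Let $(X_i)_{i\ge 0}$ be independent and identically distributed random variables with values in $\mathbb{N}$ or in $\mathbb{R}_+$ and unbounded support, and let $F(x)=\mathbb{P}(X_i\ge x)$. For $t\ge 0$ let $I(t)$ be the smallest index $i$ with $X_i\ge t$, and let $Y_t = X_0+\dots+X_{I(t)-1}$. Assume that $F(x)\sim c\,x^{-\alpha}$ as $x\to\infty$, for some constants $c>0$ and $\alpha>0$. Then, as $t\to\infty$: (i) if $\alpha<1$, $Y_t/t$ converges in distribution to the Darling--Mandelbrot law of parameter $\alpha$; (ii) if $\alpha=1$, $Y_t/(t\log t)$ converges in distribution to the exponential law (of mean $1$); (iii) if $\alpha>1$, $Y_t/(t^{\alpha}c^{-1}\mu)$ converges in distribution to the exponential law (of mean $1$), where $\mu=\mathbb{E}(X_i)$.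
   Context: For $0<\alpha<1$, the Darling--Mandelbrot law of parameter $\alpha$ is the probability distribution on $\mathbb{R}_+$ with characteristic function $$\phi_\alpha(s)=\frac{(-is)^{-\alpha}}{-\alpha\,\gamma(-\alpha,-is)}=\Biggl(1-\sum_{n=1}^\infty \frac{\alpha}{n-\alpha}\frac{(is)^n}{n!}\Biggr)^{-1},$$ where $\gamma(y,z)=\int_0^z x^{y-1}e^{-x}\,dx$ is the lower incomplete gamma function (extended by analytic continuation). The exponential law here has characteristic function $1/(1-is)$. *)

(* Defs.v *)
From HB Require Import structures.
From mathcomp Require Import all_boot all_order all_algebra finmap.
From mathcomp Require Import all_classical all_reals all_analysis.
From mathcomp Require Import measurable_realfun complex.

Set Implicit Arguments.
Unset Strict Implicit.
Unset Printing Implicit Defensive.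

Import Order.TTheory GRing.Theory Num.Theory.
Import numFieldNormedType.Exports.

Local Open Scope classical_set_scope.
Local Open Scope ring_scope.

Definition mutually_independent (R : realType) (d : measure_display)
    (T : measurableType d) (P : probability T R) (X : nat -> {RV P >-> R}) :=
  forall (J : {fset nat}) (A : nat -> set R), (forall i, measurable (A i)) ->
  P (\bigcap_(i in [set` J]) X i @^-1` A i)
  = (\prod_(i <- J) P (X i @^-1` A i))%E.

Definition identically_distributed (R : realType) (d : measure_display)
    (T : measurableType d) (P : probability T R) (X : nat -> {RV P >-> R}) :=
  forall (i : nat) (A : set R), measurable A ->
  distribution P (X i) A = distribution P (X 0%N) A.

(* F(x) = P(X >= x); the library's ccdf uses the strict inequality instead. *)
Definition upper_tail (R : realType) (d : measure_display)
    (T : measurableType d) (P : probability T R) (X : {RV P >-> R}) (x : R) : R :=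
  fine (distribution P X `[x, +oo[).

Section hitting.
Context (R : realType) (d : measure_display) (T : measurableType d)
  (P : probability T R).
Implicit Types (X : nat -> {RV P >-> R}) (t : R) (w : T).

(* The value 0 when no X_i(w) reaches level t is a convention; when the X_i are
   iid with unbounded support this only concerns a negligible set of w. *)
Definition first_passage X t w : nat :=
  match pselect (exists i, t <= X i w) with
  | left ex => ex_minn ex
  | right _ => 0%N
  end.

Definition partial_sum X n w : R := \sum_(i < n) X i w.

Definition sum_before_passage X t w : R :=
  partial_sum X (first_passage X t w) w.

Lemma first_passageS X t n w : first_passage X t w = n.+1 <->
  t <= X n.+1 w /\ forall i, (i <= n)%N -> X i w < t.
Proof.
rewrite /first_passage; case: pselect => [ex|nex]; last first.
  by split=> // -[h _]; exfalso; apply: nex; exists n.+1.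
case: ex_minnP => m tm mmin; split=> [mn|[tn lt]].
  rewrite -mn; split=> // i; rewrite -ltnS -mn ltnNge => /negP im.
  by rewrite ltNge; apply/negP => /mmin.
apply/eqP; rewrite eqn_leq mmin//= ltnNge; apply/negP => /lt.
by rewrite ltNge tm.
Qed.

Lemma measurable_first_passageS X t n :
  measurable [set w | first_passage X t w = n.+1].
Proof.
rewrite (_ : [set w | _] = (X n.+1 @^-1` `[t, +oo[) `&`
    \bigcap_(i in [set i | (i <= n)%N]) (X i @^-1` `]-oo, t[)).
  apply: measurableI; first exact: measurable_funPTI.
  by apply: bigcap_measurableType => i _; exact: measurable_funPTI.
apply/seteqP; split=> w /=.
  move=> /first_passageS[tn lt]; split; first by rewrite /= in_itv/= tn.
  by move=> i /= /lt it; rewrite in_itv/= it.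
move=> [tn lt]; apply/first_passageS; split.
  by move: tn; rewrite /= in_itv/= andbT.
by move=> i /lt /=; rewrite in_itv.
Qed.

Lemma measurable_first_passage X t :
  measurable_fun [set: T] (first_passage X t).
Proof.
have mn n : measurable [set w | first_passage X t w = n].
  case: n => [|n]; last exact: measurable_first_passageS.
  rewrite (_ : [set w | _] =
      ~` \bigcup_n [set w | first_passage X t w = n.+1]).
    apply: measurableC; apply: bigcup_measurable => n _.
    exact: measurable_first_passageS.
  apply/seteqP; split=> w /=.
    by move=> E [n _ /=]; rewrite E.
  case E : (first_passage X t w) => [//|n] nw.
  by exfalso; apply: nw; exists n.
move=> _ B _; rewrite setTI.
rewrite (_ : _ @^-1` B = \bigcup_(n in B) [set w | first_passage X t w = n]).
  exact: bigcup_measurable.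
apply/seteqP; split=> [w Bw|w [n Bn /= ->]]//.
by exists (first_passage X t w).
Qed.

Lemma measurable_partial_sum X n : measurable_fun [set: T] (partial_sum X n).
Proof. by apply: measurable_sum => i; exact: measurable_funPT. Qed.

Lemma measurable_sum_before_passage X t :
  measurable_fun [set: T] (sum_before_passage X t).
Proof.
move=> _ B mB; rewrite setTI.
rewrite (_ : _ @^-1` B = \bigcup_n
    ((first_passage X t @^-1` [set n]) `&` (partial_sum X n @^-1` B))).
  apply: bigcup_measurable => n _; apply: measurableI.
    by rewrite -[X in measurable X]setTI; exact: measurable_first_passage.
  by rewrite -[X in measurable X]setTI; exact: measurable_partial_sum.
apply/seteqP; split=> [w Bw|w [n _ [/= <-]]]//.
by exists (first_passage X t w).
Qed.

HB.instance Definition _ X t := @isMeasurableFun.Build _ _ T R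
  (sum_before_passage X t) (measurable_sum_before_passage X t).

Definition normalized_sum X t (a : R) : {RV P >-> R} :=
  scale_mfun a^-1 (sum_before_passage X t).

Lemma normalized_sumE X t a w :
  normalized_sum X t a w = sum_before_passage X t w / a.
Proof. by []. Qed.

End hitting.

Definition cvg_in_law (R : realType) (d : measure_display)
    (T : measurableType d) (P : probability T R) (Z : R -> {RV P >-> R})
    (nu : probability (measurableTypeR R) R) :=
  forall f : R -> R, continuous f -> bounded_fun f ->
  (\int[distribution P (Z t)]_x (f x)%:E)%E @[t --> +oo%R]
    --> (\int[nu]_x (f x)%:E)%E.

Local Open Scope complex_scope.

Definition charfun (R : realType) (nu : probability (measurableTypeR R) R) (s : R) : R[i] :=
  (\int[nu]_x cos (s * x))%R +i* (\int[nu]_x sin (s * x))%R.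

(* R[i]^o carries the topology of the modulus. *)
Definition darling_mandelbrot_charfun (R : realType) (alpha s : R) : R[i] :=
  (1 - limn (fun N : nat => \sum_(1 <= n < N)
     (alpha / (n%:R - alpha))%:C * ('i * s%:C) ^+ n / n`!%:R : R[i]^o))^-1.

Definition darling_mandelbrot_law (R : realType) (alpha : R)
    (nu : probability (measurableTypeR R) R) :=
  nu `[0, +oo[%classic = 1%E /\
  forall s, charfun nu s = darling_mandelbrot_charfun alpha s.

(* The canonical probability structure on exponential_prob is guarded by the
   positivity of the rate, which unification cannot infer. *)
Definition exponential_law1 (R : realType) :
    probability (measurableTypeR R) R :=
  exponential_distribution_exponential_prob__canonical__probability_measure_Probability
    (ltr01 : 0 < 1 :> R).

Lemma exponential_law1E (R : realType) :
  exponential_law1 R = exponential_prob (1 : R) :> (set (measurableTypeR R) -> \bar R).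
Proof. by []. Qed.

(* Main.v *)
(* The index of the first X_i >= t being geometric, any multiplicative character
   chi with |chi| <= 1 (here exp(-l x), or exp(i s x) split into cosine and sine)
   satisfies
     E[chi(Y_t)] * (1 + E[1 - chi(X); X < t] / F(t)) = 1,
   with F(t) = P(X >= t).  Karamata's theorem in its simplest form gives
   E[X^n; X < t] / (t^n F(t)) -> alpha / (n - alpha) for alpha < 1, and the
   corresponding first order statements for alpha >= 1; expanding chi in power
   series yields the limits of all Laplace transforms and characteristic
   functions.  Polynomials in exp(-x) being dense (Bernstein), the Laplace
   transforms control the integrals of all bounded continuous functions.  When
   alpha < 1 the limit law is built as the law of the almost sure limit of the
   quantile functions of Y_t / t. *)

Require Import Defs.
From HB Require Import structures.
From mathcomp Require Import all_boot all_order all_algebra finmap.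
From mathcomp Require Import all_classical all_reals all_analysis.
From mathcomp Require Import measurable_realfun.
From mathcomp Require Import ring lra.
Set Implicit Arguments.
Unset Strict Implicit.
Unset Printing Implicit Defensive.

Import Order.TTheory GRing.Theory Num.Theory.
Import numFieldNormedType.Exports.
Local Open Scope classical_set_scope.
Local Open Scope ring_scope.

(** * Bounded measurable functions on a probability space *)

Section bounded_measurable.
Context (d : measure_display) (T : measurableType d) (R : realType).
Implicit Types (f g : T -> R).

(** The index I(t) is unbounded, so the identity for chi is not proved through an infinite sum: Y_t
    is cut at N steps, the error is at most P(X < t)^N, and the exact identity follows because N is
    arbitrary. Characters are kept as pairs of real functions, since the integrals are real;
    multiplication by chi(X) becomes a two by two recursion. The tail is a power only
    asymptotically, so it is compared rather than integrated: the chords of E min(X, u) have slopes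
    between values of the tail, just as those of a primitive of c x^(-alpha) have slopes between
    values of its derivative. Higher moments reduce to the mean by passing to X^n. For alpha < 1
    nothing says beforehand that the limit of the Laplace transforms is itself a Laplace transform.
    The continuity theorem is therefore a comparison of two arbitrary variables, which serves as a
    Cauchy criterion and also, against a known law, as a convergence criterion. Most integrands are
    bounded and measurable, a class closed under algebra and integrable for any probability; hence
    the predicate below. *)

Definition bounded_mfun f :=
  measurable_fun [set: T] f /\ exists C : R, forall w, `|f w| <= C.

Lemma bounded_mfunP f (C : R) : measurable_fun [set: T] f ->
  (forall w, `|f w| <= C) -> bounded_mfun f.
Proof. by move=> mf fC; split => //; exists C. Qed.

Lemma bounded_mfun_cst (r : R) : bounded_mfun (fun=> r).
Proof. by apply: (@bounded_mfunP _ `|r|). Qed.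

Lemma bounded_mfunD f g : bounded_mfun f -> bounded_mfun g ->
  bounded_mfun (fun w => f w + g w).
Proof.
move=> [mf [C fC]] [mg [D gD]]; apply: (@bounded_mfunP _ (C + D)).
  exact: measurable_funD.
by move=> w; rewrite (le_trans (ler_normD _ _))// lerD.
Qed.

Lemma bounded_mfunN f : bounded_mfun f -> bounded_mfun (fun w => - f w).
Proof.
move=> [mf [C fC]]; apply: (@bounded_mfunP _ C).
  exact: measurableT_comp.
by move=> w; rewrite normrN.
Qed.

Lemma bounded_mfunB f g : bounded_mfun f -> bounded_mfun g ->
  bounded_mfun (fun w => f w - g w).
Proof. by move=> bf bg; apply: bounded_mfunD => //; exact: bounded_mfunN. Qed.

Lemma bounded_mfunM f g : bounded_mfun f -> bounded_mfun g ->
  bounded_mfun (fun w => f w * g w).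
Proof.
move=> [mf [C fC]] [mg [D gD]]; apply: (@bounded_mfunP _ (C * D)).
  exact: measurable_funM.
by move=> w; rewrite normrM ler_pM.
Qed.

Lemma bounded_mfun_sum (I : Type) (s : seq I) (F : I -> T -> R) :
  (forall i, bounded_mfun (F i)) -> bounded_mfun (fun w => \sum_(i <- s) F i w).
Proof.
move=> bF; elim: s => [|i s IH].
  by under eq_fun do rewrite big_nil; exact: bounded_mfun_cst.
by under eq_fun do rewrite big_cons; exact: bounded_mfunD.
Qed.

Lemma bounded_mfun_prod (I : Type) (s : seq I) (F : I -> T -> R) :
  (forall i, bounded_mfun (F i)) -> bounded_mfun (fun w => \prod_(i <- s) F i w).
Proof.
move=> bF; elim: s => [|i s IH].
  by under eq_fun do rewrite big_nil; exact: bounded_mfun_cst.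
by under eq_fun do rewrite big_cons; exact: bounded_mfunM.
Qed.

Lemma bounded_mfun_indic (A : set T) : measurable A -> bounded_mfun (\1_A : T -> R).
Proof.
move=> mA; apply: (@bounded_mfunP _ 1); first exact: measurable_indic.
by move=> w; rewrite indicE; case: (_ \in _); rewrite ?normr1 ?normr0.
Qed.

End bounded_measurable.

Lemma bounded_mfun_comp d (T : measurableType d) d' (U : measurableType d')
    (R : realType) (f : U -> R) (g : T -> U) :
  bounded_mfun f -> measurable_fun [set: T] g -> bounded_mfun (f \o g).
Proof.
move=> [mf [C fC]] mg; apply: (@bounded_mfunP _ _ _ _ C).
  exact: measurableT_comp.
by move=> w; exact: fC.
Qed.

Section probability_Rintegral.
Context (d : measure_display) (T : measurableType d) (R : realType)
  (P : probability T R).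
Implicit Types (f g : T -> R).

Lemma bounded_mfun_integrable f : bounded_mfun f ->
  P.-integrable [set: T] (EFin \o f).
Proof.
move=> [mf [C fC]]; apply: measurable_bounded_integrable => //.
  by rewrite (le_lt_trans (probability_le1 P _)) ?ltry.
by exists C; split; [exact: num_real|move=> x Cx w _; exact: le_trans (fC w) (ltW Cx)].
Qed.

Lemma EFin_Rintegral f : bounded_mfun f ->
  (\int[P]_w f w)%:E = (\int[P]_w (f w)%:E)%E.
Proof.
move=> bf; rewrite /Rintegral fineK//; apply: integrable_fin_num => //.
exact: bounded_mfun_integrable.
Qed.

Lemma PintD f g : bounded_mfun f -> bounded_mfun g ->
  \int[P]_w (f w + g w) = \int[P]_w f w + \int[P]_w g w.
Proof. by move=> bf bg; apply: RintegralD => //; exact: bounded_mfun_integrable. Qed.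

Lemma PintB f g : bounded_mfun f -> bounded_mfun g ->
  \int[P]_w (f w - g w) = \int[P]_w f w - \int[P]_w g w.
Proof. by move=> bf bg; apply: RintegralB => //; exact: bounded_mfun_integrable. Qed.

Lemma PintZl f r : bounded_mfun f -> \int[P]_w (r * f w) = r * \int[P]_w f w.
Proof. by move=> bf; apply: RintegralZl => //; exact: bounded_mfun_integrable. Qed.

Lemma PintZr f r : bounded_mfun f -> \int[P]_w (f w * r) = \int[P]_w f w * r.
Proof. by move=> bf; apply: RintegralZr => //; exact: bounded_mfun_integrable. Qed.

Lemma Pint_cst r : \int[P]_(w in [set: T]) r = r.
Proof. by rewrite Rintegral_cst//= probability_setT mulr1. Qed.

Lemma Pint_sum (I : Type) (s : seq I) (F : I -> T -> R) :
  (forall i, bounded_mfun (F i)) ->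
  \int[P]_w (\sum_(i <- s) F i w) = \sum_(i <- s) \int[P]_w F i w.
Proof.
move=> bF; elim: s => [|i s IH].
  by under eq_Rintegral do rewrite big_nil; rewrite Pint_cst big_nil.
under eq_Rintegral do rewrite big_cons.
by rewrite PintD// ?IH ?big_cons//; exact: bounded_mfun_sum.
Qed.

Lemma le_Pint f g : bounded_mfun f -> bounded_mfun g ->
  (forall w, f w <= g w) -> \int[P]_w f w <= \int[P]_w g w.
Proof.
by move=> bf bg fg; apply: le_Rintegral => //; exact: bounded_mfun_integrable.
Qed.

Lemma ler_norm_Pint f g : bounded_mfun f -> bounded_mfun g ->
  (forall w, `|f w| <= g w) -> `|\int[P]_w f w| <= \int[P]_w g w.
Proof.
move=> bf bg fg; rewrite ler_norml -mulN1r -PintZl//; apply/andP; split.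
  apply: le_Pint => // [|w]; first exact: bounded_mfunM (bounded_mfun_cst _ _) bg.
  by rewrite mulN1r; have := fg w; rewrite ler_norml => /andP[].
by apply: le_Pint => // w; exact: le_trans (ler_norm _) (fg w).
Qed.

Lemma ler_norm_Pint_cst f C : bounded_mfun f -> (forall w, `|f w| <= C) ->
  `|\int[P]_w f w| <= C.
Proof.
move=> bf fC; rewrite -[leRHS]Pint_cst; apply: ler_norm_Pint => //.
exact: bounded_mfun_cst.
Qed.

Lemma Pint_indic (A : set T) : measurable A ->
  \int[P]_w (\1_A w : R) = fine (P A).
Proof. by move=> mA; rewrite /Rintegral integral_indic// setIT. Qed.

End probability_Rintegral.

(** * Independence *)

Section level_approximation.
Context (R : realType).

(* Layer-cake approximation of [x] by the number of levels [j / N] below it. *)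
Lemma level_sum_approx (N : nat) (x : R) : 0 <= x <= 1 ->
  `|x - N.+1%:R^-1 * \sum_(j < N.+1) (j.+1%:R / N.+1%:R <= x)%R%:R| <= N.+1%:R^-1.
Proof.
move=> /andP[x0 x1]; have N0 : 0 < N.+1%:R :> R by [].
set y := N.+1%:R * x; have y0 : 0 <= y by rewrite mulr_ge0.
set m := Num.truncn y; have [my ym] := andP (truncn_itv y0).
have mN : (m <= N.+1)%N.
  by rewrite -(ler_nat R) (le_trans my)// /y ger_pMr.
have -> : \sum_(j < N.+1) (j.+1%:R / N.+1%:R <= x)%R%:R = m%:R :> R.
  transitivity (\sum_(j < N.+1) (if (j < m)%N then 1 else 0 : R)).
    apply: eq_bigr => j _; rewrite ler_pdivrMr// mulrC -/y.
    have -> : (j.+1%:R <= y) = (j < m)%N.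
      apply/idP/idP => [jy|jm]; last by rewrite (le_trans _ my)// ler_nat.
      by rewrite -ltnS -(ltr_nat R); exact: le_lt_trans jy ym.
    by case: ifP.
  rewrite -big_mkcond/= sumr_const; congr (_%:R).
  rewrite cardE /enum_mem -enumT/= size_filter.
  rewrite (@eq_count _ _ (preim val (fun j => (j < m)%N)))//.
  rewrite -count_map val_enum_ord.
  rewrite -(subnKC mN) iotaD count_cat add0n.
  rewrite (_ : count _ (iota 0 m) = m); last first.
    rewrite -[RHS](size_iota 0); apply/eqP; rewrite -all_count.
    by apply/allP => j; rewrite mem_iota add0n.
  rewrite (_ : count _ _ = 0%N) ?addn0//; apply/eqP; rewrite -leqn0 leqNgt -has_count.
  by apply/hasPn => j; rewrite mem_iota -leqNgt => /andP[].
have -> : x - N.+1%:R^-1 * m%:R = N.+1%:R^-1 * (y - m%:R).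
  by rewrite mulrBr /y mulKf ?gt_eqF.
rewrite normrM gtr0_norm ?invr_gt0// ger0_norm ?subr_ge0//.
by rewrite ler_piMr ?invr_ge0// lerBlDr addrC natr1; exact: ltW.
Qed.

End level_approximation.

Section independence.
Context (R : realType) (d : measure_display) (T : measurableType d)
  (P : probability T R).

Lemma bounded_mfun_preimage (Y : {RV P >-> R}) (A : set R) : measurable A ->
  bounded_mfun (fun w => \1_A (Y w) : R).
Proof.
by move=> mA; exact: (bounded_mfun_comp (bounded_mfun_indic _ mA)).
Qed.

(** Both sides are affine in [h], so [h] may be rescaled into [0, 1], where it is uniformly close to
    an average of indicators of its level sets; on those the hypothesis on sets applies. [Z] differs
    from [Y] so that the factor taken out can be expressed with [X 0]. *)
Lemma Pint_decorrelate (V : T -> R) (Y Z : {RV P >-> R}) (h : R -> R) :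
  bounded_mfun V -> bounded_mfun h ->
  (forall B, measurable B -> \int[P]_w (V w * \1_B (Y w)) =
    (\int[P]_w V w) * \int[P]_w \1_B (Z w)) ->
  \int[P]_w (V w * h (Y w)) = (\int[P]_w V w) * \int[P]_w h (Z w).
Proof.
move=> bV [mh [C hC]] VB.
have [mV [D VD]] := bV.
have C0 : 0 <= C by exact: le_trans (normr_ge0 _) (hC 0).
have D0 : 0 <= D.
  (* The bound [D] is known only at points of [T]; there is one because [T] has mass 1. *)
  have [t _] : [set: T] !=set0.
    apply/set0P/eqP => T0; have := probability_setT P.
    by rewrite T0 measure0 => -[] /esym/eqP; rewrite oner_eq0.
  exact: le_trans (normr_ge0 _) (VD t).
(* The extra 1 keeps [2 * K] invertible even when [C] is 0. *)
pose K := C + 1; have K0 : 0 < K by rewrite /K; lra.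
pose g x := (h x + K) / (2 * K).
have g01 x : 0 <= g x <= 1.
  have := hC x; rewrite ler_norml => /andP[h1 h2]; rewrite /g.
  rewrite divr_ge0 ?ler_pdivrMr ?mul1r; rewrite /K; lra.
have mg : measurable_fun setT g by exact: measurable_funM (measurable_funD mh _) _.
have bh : bounded_mfun h by split=> //; exists C.
have bg : bounded_mfun g.
  by apply: (bounded_mfunP mg (C := 1)) => x; have /andP[? ?] := g01 x; rewrite ger0_norm.
have mS r : measurable [set x | r <= g x].
  rewrite -[X in measurable X]setTI; rewrite (_ : [set x | _] = g @^-1` `[r, +oo[).
    exact: mg.
  by apply/seteqP; split => x /=; rewrite in_itv/= andbT.
suff Hg : \int[P]_w (V w * g (Y w)) = (\int[P]_w V w) * \int[P]_w g (Z w).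
  have hg x : h x = 2 * K * g x - K by rewrite /g; field; lra.
  have bgY (U : {RV P >-> R}) : bounded_mfun (fun w => g (U w)).
    exact: (bounded_mfun_comp bg).
  under eq_Rintegral do rewrite hg mulrBr mulrCA.
  rewrite (_ : \int[P]_w h (Z w) = \int[P]_w (2 * K * g (Z w) - K)); last first.
    by apply: eq_Rintegral => w _; rewrite hg.
  have bVg := bounded_mfunM bV (bgY Y).
  have bK : bounded_mfun (fun=> K : R) := @bounded_mfun_cst _ T R K.
  have b2K : bounded_mfun (fun=> 2 * K : R) := @bounded_mfun_cst _ T R (2 * K).
  rewrite (PintB _ (bounded_mfunM b2K bVg) (bounded_mfunM bV bK)).
  rewrite (PintB _ (bounded_mfunM b2K (bgY Z)) bK).
  rewrite (PintZl _ _ bVg) (PintZl _ _ (bgY Z)) (PintZr _ _ bV) Pint_cst Hg.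
  ring.
apply/eqP; rewrite -subr_eq0 -normr_le0; apply/ler_addgt0Pl => e e0; rewrite addr0.
(* Replacing [g] by its level sum costs at most [D / N.+1] on each side of the equation, hence the
   factor 2. *)
have [N Ne] : exists N : nat, 2 * D * N.+1%:R^-1 <= e.
  exists (Num.truncn (2 * D / e)); rewrite ler_pdivrMr// -ler_pdivrMl// mulrC.
  by apply: ltW; exact: truncnS_gt.
apply: le_trans Ne.
pose gN (x : R) : R := N.+1%:R^-1 * \sum_(j < N.+1) \1_[set x | j.+1%:R / N.+1%:R <= g x] x.
have bgN : bounded_mfun gN.
  apply: bounded_mfunM; first exact: bounded_mfun_cst.
  by apply: bounded_mfun_sum => j; exact: bounded_mfun_indic.
have gNE x : `|g x - gN x| <= N.+1%:R^-1.
  rewrite /gN; under eq_bigr do rewrite indicE mem_setE/=.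
  exact: level_sum_approx.
have bY (U : {RV P >-> R}) (f : R -> R) : bounded_mfun f -> bounded_mfun (fun w => f (U w)).
  by move=> bf; exact: (bounded_mfun_comp bf).
have HN : \int[P]_w (V w * gN (Y w)) = (\int[P]_w V w) * \int[P]_w gN (Z w).
  rewrite /gN.
  under eq_Rintegral do rewrite mulrCA mulr_sumr.
  rewrite PintZl; last first.
    apply: bounded_mfun_sum => j; apply: bounded_mfunM => //.
    exact: bounded_mfun_preimage.
  rewrite Pint_sum; last by move=> j; apply: bounded_mfunM => //; exact: bounded_mfun_preimage.
  rewrite PintZl; last by apply: bounded_mfun_sum => j; exact: bounded_mfun_preimage.
  rewrite Pint_sum; last by move=> j; exact: bounded_mfun_preimage.
  rewrite mulrCA; congr (_ * _); rewrite mulr_sumr; apply: eq_bigr => j _.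
  by rewrite VB.
have bd := bounded_mfunB bg bgN.
rewrite (_ : _ - _ = \int[P]_w (V w * (g (Y w) - gN (Y w))) -
   (\int[P]_w V w) * \int[P]_w (g (Z w) - gN (Z w))); last first.
  have bgY := bY Y _ bg; have bgNY := bY Y _ bgN.
  rewrite (PintB _ (bY Z _ bg) (bY Z _ bgN)) mulrBr -HN.
  rewrite (_ : \int[P]_w (V w * (g (Y w) - gN (Y w))) =
      \int[P]_w (V w * g (Y w)) - \int[P]_w (V w * gN (Y w))); last first.
    rewrite -(PintB _ (bounded_mfunM bV bgY) (bounded_mfunM bV bgNY)).
    by apply: eq_Rintegral => w _; rewrite mulrBr.
  by ring.
rewrite (le_trans (ler_normB _ _))//.
have -> : 2 * D * N.+1%:R^-1 = D * N.+1%:R^-1 + D * N.+1%:R^-1 by ring.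
apply: lerD.
  apply: ler_norm_Pint_cst => [|w]; first by apply: bounded_mfunM => //;
    exact: (bY _ (fun x => g x - gN x) bd).
  by rewrite normrM ler_pM.
rewrite normrM ler_pM//; first exact: ler_norm_Pint_cst.
by apply: ler_norm_Pint_cst => //; exact: (bY _ (fun x => g x - gN x) bd).
Qed.


Context (X : nat -> {RV P >-> R}).
Hypothesis X_indep : mutually_independent X.
Hypothesis X_ident : identically_distributed X.

(** A weighted form of independence from [X k], [X k.+1], and so on: the test is linear in [W],
    which may be signed, and the marginals on the right are already those of [X 0]. Linearity is
    what the addition formulas of cosine and sine call for. *)
Definition independent_of_tail (k : nat) (W : T -> R) :=
  bounded_mfun W /\
  forall (n : nat) (A : nat -> set R), (forall i, measurable (A i)) ->
    \int[P]_w (W w * \prod_(k <= i < n) \1_(A i) (X i w)) =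
    (\int[P]_w W w) * \prod_(k <= i < n) \int[P]_w \1_(A i) (X 0%N w).

Lemma Pint_indic_ident (i : nat) (A : set R) : measurable A ->
  \int[P]_w (\1_A (X i w) : R) = \int[P]_w \1_A (X 0%N w).
Proof.
move=> mA.
have E j : \int[P]_w (\1_A (X j w) : R) = fine (distribution P (X j) A).
  rewrite /distribution/= /pushforward/= -Pint_indic//.
  by rewrite -[X in measurable X]setTI; exact: (measurable_funPT (X j)).
by rewrite !E X_ident.
Qed.

Lemma independent_of_tail0 : independent_of_tail 0 (fun=> 1).
Proof.
split=> [|n A mA]; first exact: bounded_mfun_cst.
rewrite Pint_cst mul1r.
have mXA i : measurable (X i @^-1` A i).
  by rewrite -[X in measurable X]setTI; exact: (measurable_funPT (X i)).
pose J := [fset i in iota 0 n]%fset.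
have JE (F : nat -> \bar R) : (\prod_(i <- J) F i = \prod_(0 <= i < n) F i)%E.
  apply: perm_big; apply: uniq_perm; rewrite ?fset_uniq ?iota_uniq//.
  by move=> i; rewrite !inE /index_iota subn0.
have := X_indep J mA; rewrite JE => /(congr1 fine).
have -> : (\prod_(0 <= i < n) P (X i @^-1` A i) =
    (\prod_(0 <= i < n) \int[P]_w (\1_(A i) (X 0%N w) : R))%:E)%E.
  rewrite -prodEFin; apply: eq_bigr => i _.
  rewrite -(Pint_indic_ident i (mA i)).
  by rewrite (_ : \int[P]_w _ = fine (P (X i @^-1` A i))) ?fineK ?fin_num_measure// -Pint_indic.
move=> /= <-; rewrite -Pint_indic; last first.
  by apply: bigcap_measurableType => i _; exact: mXA.
apply: eq_Rintegral => w _; rewrite mul1r indicE.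
have [wJ|wJ] := boolP (w \in _).
  rewrite big1_seq// => i /=; rewrite mem_index_iota => /andP[_ iin].
  move: wJ; rewrite inE => /(_ i) wJ; rewrite indicE mem_set//; apply: wJ.
  by rewrite /= !inE mem_iota.
apply/eqP; rewrite eq_sym; apply/eqP/eqP.
move: wJ; rewrite notin_setE => wJ.
have [i iJ iA] : exists2 i, i \in J & ~ A i (X i w).
  apply: contrapT => H; apply: wJ => i /= iJ; apply: contrapT => nA.
  by apply: H; exists i.
rewrite (bigD1_seq i)/= ?iota_uniq//; last by move: iJ; rewrite !inE /index_iota subn0.
by rewrite indicE memNset// mul0r.
Qed.

Lemma independent_of_tail_lin (k : nat) (a b : R) (V W : T -> R) :
  independent_of_tail k V -> independent_of_tail k W ->
  independent_of_tail k (fun w => a * V w + b * W w).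
Proof.
move=> [bV iV] [bW iW]; split.
  by apply: bounded_mfunD; apply: bounded_mfunM => //; exact: bounded_mfun_cst.
move=> n A mA.
have bA : bounded_mfun (fun w => \prod_(k <= i < n) \1_(A i) (X i w) : R).
  by apply: bounded_mfun_prod => i; exact: bounded_mfun_preimage.
have bVA := bounded_mfunM bV bA; have bWA := bounded_mfunM bW bA.
have ba := @bounded_mfun_cst _ T R a; have bb := @bounded_mfun_cst _ T R b.
under eq_Rintegral do rewrite mulrDl -!mulrA.
rewrite (PintD _ (bounded_mfunM ba bVA) (bounded_mfunM bb bWA)).
rewrite (PintD _ (bounded_mfunM ba bV) (bounded_mfunM bb bW)).
rewrite (PintZl _ _ bVA) (PintZl _ _ bWA) (PintZl _ _ bV) (PintZl _ _ bW).
by rewrite iV// iW//; ring.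
Qed.

Lemma Pint_independent_of_tail (k : nat) (W : T -> R) (h : R -> R) :
  independent_of_tail k W -> bounded_mfun h ->
  \int[P]_w (W w * h (X k w)) = (\int[P]_w W w) * \int[P]_w h (X 0%N w).
Proof.
move=> [bW iW] bh; apply: Pint_decorrelate => // B mB.
by have := iW k.+1 (fun=> B) (fun=> mB); under eq_Rintegral do rewrite big_nat1;
  rewrite big_nat1.
Qed.

(** Grouping [W] with the later indicators gives a variable [V]. The hypothesis on [W], with an
    arbitrary set at place [k], says that [V] decorrelates from [X k] on sets, and
    [Pint_decorrelate] passes from sets to [h]. *)
Lemma independent_of_tailM (k : nat) (W : T -> R) (h : R -> R) :
  independent_of_tail k W -> bounded_mfun h ->
  independent_of_tail k.+1 (fun w => W w * h (X k w)).
Proof.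
move=> iW bh; have [bW iW'] := iW; split.
  by apply: bounded_mfunM => //; exact: (bounded_mfun_comp bh).
move=> n A mA; rewrite (Pint_independent_of_tail iW bh).
have [nk|kn] := leqP n k.+1.
  rewrite big_geq// mulr1; under eq_Rintegral do rewrite big_geq// mulr1.
  exact: Pint_independent_of_tail.
pose V w := W w * \prod_(k.+1 <= i < n) \1_(A i) (X i w).
have bV : bounded_mfun V.
  apply: bounded_mfunM => //.
  by apply: bounded_mfun_prod => i; exact: bounded_mfun_preimage.
(* The free set [B] is inserted at place [k] in the given family; taking the whole line for [B]
   later yields the integral of [V]. *)
pose A' B := fun i => if i == k then B else A i.
have mA' B : measurable B -> forall i, measurable (A' B i).
  by move=> mB i; rewrite /A'; case: ifP.
have A'E B w : \prod_(k <= i < n) (\1_(A' B i) (X i w) : R) =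
    \1_B (X k w) * \prod_(k.+1 <= i < n) \1_(A i) (X i w).
  rewrite big_ltn ?(ltnW kn)//; congr (_ * _); first by rewrite /A' eqxx.
  by apply: eq_big_nat => i /andP[ki _]; rewrite /A' gtn_eqF.
have VB B : measurable B -> \int[P]_w (V w * \1_B (X k w)) =
    (\int[P]_w W w) * \prod_(k.+1 <= i < n) (\int[P]_w \1_(A i) (X 0%N w))
    * \int[P]_w \1_B (X 0%N w).
  move=> mB; have := iW' n _ (mA' _ mB); under eq_Rintegral do rewrite A'E.
  have -> : \prod_(k <= i < n) (\int[P]_w \1_(A' B i) (X 0%N w) : R) =
      \int[P]_w \1_B (X 0%N w) * \prod_(k.+1 <= i < n) \int[P]_w \1_(A i) (X 0%N w).
    rewrite big_ltn ?(ltnW kn)//; congr (_ * _); first by rewrite /A' eqxx.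
    by apply: eq_big_nat => i /andP[ki _]; rewrite /A' gtn_eqF.
  move=> E; transitivity (\int[P]_w (W w *
    (\1_B (X k w) * \prod_(k.+1 <= i < n) \1_(A i) (X i w)))).
    by apply: eq_Rintegral => w _; rewrite /V; ring.
  by rewrite E; ring.
have V1 : \int[P]_w V w = (\int[P]_w W w) * \prod_(k.+1 <= i < n) (\int[P]_w \1_(A i) (X 0%N w)).
  have := VB setT measurableT; under eq_Rintegral do rewrite indicT mulr1.
  rewrite [X in _ = _ * X -> _](_ : _ = 1) ?mulr1// -[RHS](Pint_cst P).
  by apply: eq_Rintegral => w _; rewrite indicT.
transitivity (\int[P]_w (V w * h (X k w))).
  by apply: eq_Rintegral => w _; rewrite /V; ring.
rewrite (@Pint_decorrelate V (X k) (X 0%N) h bV bh).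
  by rewrite V1; ring.
by move=> B mB; rewrite VB// V1.
Qed.

End independence.

(** * Sums stopped at the first passage *)

Lemma eq0_le_expr (R : realType) (z C q : R) : 0 <= q < 1 ->
  (forall N : nat, `|z| <= C * q ^+ N) -> z = 0.
Proof.
move=> /andP[q0 q1] zC; apply/eqP; rewrite -normr_le0.
have qq : C * q ^+ N @[N --> \oo] --> C * 0.
  by apply: cvgMl_tmp; apply: cvg_expr; rewrite ger0_norm.
rewrite mulr0 in qq; rewrite -(cvg_lim (@Rhausdorff R) qq).
by apply: limr_ge; [apply/cvg_ex; exists 0|apply: nearW].
Qed.

Section killed_sums.
Context (R : realType) (d : measure_display) (T : measurableType d)
  (P : probability T R) (X : nat -> {RV P >-> R}).
Hypothesis X_indep : mutually_independent X.
Hypothesis X_ident : identically_distributed X.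
Hypothesis X_ge0 : forall i w, 0 <= X i w.

(** The value of the character at step n on the event that level t has not been reached yet, and 0
    afterwards. The interval starts at 0 because exp(- l x) is bounded only on the half-line of
    nonnegative x. *)
Definition killed_sum (a : R -> R) (t : R) (n : nat) (w : T) : R :=
  a (partial_sum X n w) * \prod_(i < n) \1_`[0, t[ (X i w).

Lemma partial_sum_ge0 n w : 0 <= partial_sum X n w.
Proof. exact: sumr_ge0. Qed.

Lemma killed_prodE t n w :
  \prod_(i < n) (\1_`[0, t[ (X i w) : R) = [forall i : 'I_n, X i w < t]%:R.
Proof.
have [/forallP h|] := boolP [forall i : 'I_n, X i w < t].
  rewrite big1// => i _; rewrite indicE mem_set//= in_itv/= X_ge0; exact: h.
rewrite negb_forall => /existsP[i]; rewrite -leNgt => ti.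
by rewrite (bigD1 i)//= indicE memNset ?mul0r//= in_itv/= X_ge0 ltNge ti.
Qed.

Lemma bounded_mfun_indic_itv (a : R -> R) (t : R) : measurable_fun setT a ->
  (forall x, 0 <= x -> `|a x| <= 1) -> bounded_mfun (fun x => a x * \1_`[0, t[ x).
Proof.
move=> ma a1; apply: (@bounded_mfunP _ _ _ _ 1).
  by apply: measurable_funM => //; exact: measurable_indic.
move=> x; rewrite indicE; have [|_] := boolP (x \in _); last by rewrite mulr0 normr0.
by rewrite inE/= in_itv/= mulr1 => /andP[x0 _]; exact: a1.
Qed.

Lemma norm_killed_sum a t n w : (forall x, 0 <= x -> `|a x| <= 1) ->
  `|killed_sum a t n w| <= killed_sum (fun=> 1) t n w.
Proof.
move=> a1; rewrite /killed_sum killed_prodE normrM mul1r normr_nat.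
by rewrite ler_piMl// a1// partial_sum_ge0.
Qed.

(** If the passage occurs before step N, only the term at the passage index survives and the
    difference is 0. Otherwise every term vanishes and what remains is one value of [a], of modulus
    at most 1; this case also covers paths that never reach t, whatever value [first_passage] takes
    there. *)
Lemma passage_decomposition a t N w : (forall x, 0 <= x -> `|a x| <= 1) ->
  `|a (sum_before_passage X t w) -
    \sum_(n < N) killed_sum a t n w * \1_`[t, +oo[ (X n w)|
  <= killed_sum (fun=> 1) t N w.
Proof.
move=> a1.
have e0 n : X n w < t -> \1_`[t, +oo[ (X n w) = 0 :> R.
  by move=> Xt; rewrite indicE memNset//= in_itv/= andbT leNgt Xt.
have [/forallP h|] := boolP [forall i : 'I_N, X i w < t].
  rewrite big1 => [|i _]; last by rewrite e0 ?mulr0.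
  rewrite subr0 /killed_sum killed_prodE mul1r (introT forallP)//.
  by rewrite a1// partial_sum_ge0.
rewrite negb_forall => /existsP[i]; rewrite -leNgt => ti.
rewrite /sum_before_passage /first_passage.
case: pselect => [ex|nex]; last by exfalso; apply: nex; exists i.
case: ex_minnP => m tm mmin.
have mN : (m < N)%N by exact: leq_ltn_trans (mmin _ ti) (ltn_ord i).
rewrite (bigD1 (Ordinal mN))//= [X in _ - (_ + X)]big1 ?addr0 => [|n nm].
  rewrite {1}indicE mem_set/=; last by rewrite in_itv/= tm.
  rewrite mulr1 /killed_sum [X in _ - _ * X]killed_prodE.
  rewrite (introT forallP) ?mulr1 ?subrr ?normr0; last first.
    by move=> j; rewrite ltNge; apply/negP => /mmin; rewrite leqNgt ltn_ord.
  by rewrite mul1r killed_prodE.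
have [nlt|mlt|nem] := ltngtP n m; last by move: nm; rewrite -val_eqE/= nem eqxx.
  by rewrite e0 ?mulr0// ltNge; apply/negP => /mmin; rewrite leqNgt nlt.
rewrite /killed_sum killed_prodE; case: forallP => [h|_]; last by rewrite mulr0 mul0r.
by have := h (Ordinal mlt); rewrite /= ltNge tm.
Qed.

Lemma killed_prod_independent t n :
  independent_of_tail X n (killed_sum (fun=> 1) t n) /\
  \int[P]_w killed_sum (fun=> 1) t n w = (\int[P]_w \1_`[0, t[ (X 0%N w)) ^+ n.
Proof.
have b1 : bounded_mfun (\1_`[0, t[ : R -> R) by exact: bounded_mfun_indic.
elim: n => [|n [iW IH]].
  have -> : killed_sum (fun=> 1) t 0 = fun=> 1.
    by apply/funext => w; rewrite /killed_sum big_ord0 mul1r.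
  by split; [exact: independent_of_tail0|rewrite expr0 Pint_cst].
have -> : killed_sum (fun=> 1) t n.+1 =
    fun w => killed_sum (fun=> 1) t n w * \1_`[0, t[ (X n w).
  by apply/funext => w; rewrite /killed_sum big_ord_recr/= mulrA.
split; first exact: independent_of_tailM.
by rewrite (Pint_independent_of_tail iW b1) IH exprSr.
Qed.

(* [a] and [b] are the real and imaginary parts of a multiplicative character. *)
Section character.
Variables (a b : R -> R) (t : R).
Hypothesis ma : measurable_fun setT a.
Hypothesis mb : measurable_fun setT b.
Hypothesis a1 : forall x, 0 <= x -> `|a x| <= 1.
Hypothesis b1 : forall x, 0 <= x -> `|b x| <= 1.
Hypothesis a0 : a 0 = 1.
Hypothesis b0 : b 0 = 0.
Hypothesis aD : forall x y, 0 <= x -> 0 <= y -> a (x + y) = a x * a y - b x * b y.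
Hypothesis bD : forall x y, 0 <= x -> 0 <= y -> b (x + y) = a x * b y + b x * a y.

Let ha x := a x * \1_`[0, t[ x.
Let hb x := b x * \1_`[0, t[ x.

(** The explicit coefficients 1 and -1 give the linear combination the shape expected by
    [independent_of_tail_lin]. *)
Lemma killed_sumSa n w :
  killed_sum a t n.+1 w = 1 * (killed_sum a t n w * ha (X n w)) +
    (-1) * (killed_sum b t n w * hb (X n w)).
Proof.
rewrite /killed_sum /ha /hb big_ord_recr/= /partial_sum big_ord_recr/=.
by rewrite aD ?sumr_ge0//; ring.
Qed.

Lemma killed_sumSb n w :
  killed_sum b t n.+1 w = 1 * (killed_sum a t n w * hb (X n w)) +
    1 * (killed_sum b t n w * ha (X n w)).
Proof.
rewrite /killed_sum /ha /hb big_ord_recr/= /partial_sum big_ord_recr/=.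
by rewrite bD ?sumr_ge0//; ring.
Qed.

Let bha : bounded_mfun ha := bounded_mfun_indic_itv t ma a1.
Let bhb : bounded_mfun hb := bounded_mfun_indic_itv t mb b1.

(** The two parts are treated in one induction because the addition formulas mix them. *)
Lemma killed_sum_independent n :
  independent_of_tail X n (killed_sum a t n) /\
  independent_of_tail X n (killed_sum b t n).
Proof.
elim: n => [|n [IHa IHb]].
  have E : killed_sum a t 0 = fun=> 1.
    by apply/funext => w; rewrite /killed_sum /partial_sum !big_ord0 a0 mul1r.
  have E0 : killed_sum b t 0 = fun=> 0 * 1 + 0 * 1.
    by apply/funext => w; rewrite /killed_sum /partial_sum !big_ord0 b0 !mul0r addr0.
  have i0 := independent_of_tail0 X_indep X_ident.
  by rewrite E E0; split => //; exact: independent_of_tail_lin.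
rewrite (funext (killed_sumSa n)) (funext (killed_sumSb n)).
by split; apply: independent_of_tail_lin; exact: independent_of_tailM.
Qed.

Let x n := \int[P]_w killed_sum a t n w.
Let y n := \int[P]_w killed_sum b t n w.
Let al := \int[P]_w ha (X 0%N w).
Let be := \int[P]_w hb (X 0%N w).

Let ia n := (killed_sum_independent n).1.
Let ib n := (killed_sum_independent n).2.

Let bhX (h : R -> R) n : bounded_mfun h -> bounded_mfun (fun w => h (X n w)).
Proof. by move=> bh; exact: (bounded_mfun_comp bh). Qed.

(** Together with the next recursion this says that x n + i y n is the n-th power of al + i be. *)
Let xS n : x n.+1 = x n * al - y n * be.
Proof.
rewrite /x; under eq_Rintegral do rewrite killed_sumSa mul1r mulN1r.
rewrite PintB; last 2 first.
- by apply: bounded_mfunM; [exact: (ia n).1|exact: bhX].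
- by apply: bounded_mfunM; [exact: (ib n).1|exact: bhX].
by rewrite (Pint_independent_of_tail (ia n) bha) (Pint_independent_of_tail (ib n) bhb).
Qed.

Let yS n : y n.+1 = x n * be + y n * al.
Proof.
rewrite /y; under eq_Rintegral do rewrite killed_sumSb !mul1r.
rewrite PintD; last 2 first.
- by apply: bounded_mfunM; [exact: (ia n).1|exact: bhX].
- by apply: bounded_mfunM; [exact: (ib n).1|exact: bhX].
by rewrite (Pint_independent_of_tail (ia n) bhb) (Pint_independent_of_tail (ib n) bha).
Qed.

Let F := \int[P]_w \1_`[t, +oo[ (X 0%N w) : R.

Lemma Pint_killed_sum_passage (c : R -> R) n :
  independent_of_tail X n (killed_sum c t n) ->
  \int[P]_w (killed_sum c t n w * \1_`[t, +oo[ (X n w)) =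
  (\int[P]_w killed_sum c t n w) * F.
Proof.
by move=> ic; apply: (Pint_independent_of_tail ic); exact: bounded_mfun_indic.
Qed.

Let u := \int[P]_w a (sum_before_passage X t w).
Let v := \int[P]_w b (sum_before_passage X t w).
Let q := \int[P]_w \1_`[0, t[ (X 0%N w) : R.

Lemma bounded_mfun_sum_before_passage (c : R -> R) : measurable_fun setT c ->
  (forall x, 0 <= x -> `|c x| <= 1) ->
  bounded_mfun (fun w => c (sum_before_passage X t w)).
Proof.
move=> mc c1; apply: (@bounded_mfunP _ _ _ _ 1).
  by apply: measurableT_comp => //; exact: measurable_sum_before_passage.
by move=> w; apply: c1; exact: partial_sum_ge0.
Qed.

Lemma Pint_passage_approx (c : R -> R) N : measurable_fun setT c ->
  (forall x, 0 <= x -> `|c x| <= 1) ->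
  (forall n, independent_of_tail X n (killed_sum c t n)) ->
  `|\int[P]_w c (sum_before_passage X t w) -
    F * \sum_(n < N) \int[P]_w killed_sum c t n w| <= q ^+ N.
Proof.
move=> mc c1 ic; have [i1 <-] := killed_prod_independent t N.
have bt n : bounded_mfun (fun w => killed_sum c t n w * \1_`[t, +oo[ (X n w)).
  apply: bounded_mfunM; first exact: (ic n).1.
  by apply: bhX; exact: bounded_mfun_indic.
rewrite mulr_sumr; under eq_bigr do rewrite mulrC -(Pint_killed_sum_passage (ic _)).
rewrite -Pint_sum// -PintB; last 2 first.
- exact: bounded_mfun_sum_before_passage.
- exact: bounded_mfun_sum.
apply: ler_norm_Pint => //; last by move=> w; exact: passage_decomposition.
  apply: bounded_mfunB; last exact: bounded_mfun_sum.
  exact: bounded_mfun_sum_before_passage.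
exact: i1.1.
Qed.

Lemma Pint_indic_itvC : q = 1 - F.
Proof.
have bI (A : set R) : measurable A -> bounded_mfun (fun w => \1_A (X 0%N w) : R).
  by move=> mA; apply: bhX; exact: bounded_mfun_indic.
rewrite -(Pint_cst P 1) -PintB//; [|exact: bounded_mfun_cst|exact: bI].
apply: eq_Rintegral => w _; rewrite !indicE.
have [wt|tw] := ltP (X 0%N w) t.
  rewrite mem_set ?memNset ?subr0//= in_itv/= ?X_ge0 ?wt//.
  by rewrite leNgt wt.
rewrite memNset ?mem_set ?subrr//= in_itv/= ?tw//.
by rewrite ltNge tw andbF.
Qed.

(** The killed integrals are the powers of al + i be, so their partial sums telescope against 1 - al
    - i be. Multiplying the approximation of u + i v by this factor leaves F up to O(q^N), and 0 < F
    makes q smaller than 1. *)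
Lemma passage_character : 0 < F ->
  u * (1 - al) + v * be = F /\ v * (1 - al) - u * be = 0.
Proof.
move=> F0.
have bI (A : set R) : measurable A -> bounded_mfun (fun w => \1_A (X 0%N w) : R).
  by move=> mA; apply: bhX; exact: bounded_mfun_indic.
have indic_le1 (A : set R) z : `|\1_A z : R| <= 1.
  by rewrite indicE normr_nat lern1 leq_b1.
have F1 : F <= 1.
  by apply: le_trans (ler_norm _) _; apply: ler_norm_Pint_cst => //; exact: bI.
have q01 : 0 <= q < 1 by rewrite Pint_indic_itvC; lra.
have bX h : bounded_mfun h -> (forall z, `|h z| <= 1) ->
    `|\int[P]_w h (X 0%N w)| <= 1.
  by move=> bh h1; apply: ler_norm_Pint_cst => //; exact: (bhX 0%N bh).
have hle1 (c : R -> R) z : (forall x, 0 <= x -> `|c x| <= 1) ->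
    `|c z * \1_`[0, t[ z| <= 1.
  move=> c1; rewrite indicE; have [|_] := boolP (z \in _); last first.
    by rewrite mulr0 normr0.
  by rewrite inE/= in_itv/= mulr1 => /andP[z0 _]; exact: c1.
have al1 : `|al| <= 1 by apply: bX => // z; exact: hle1.
have be1 : `|be| <= 1 by apply: bX => // z; exact: hle1.
have xq n : `|x n| <= q ^+ n.
  have [i1 <-] := killed_prod_independent t n.
  apply: ler_norm_Pint; [exact: (ia n).1|exact: i1.1|].
  by move=> w; exact: norm_killed_sum.
have yq n : `|y n| <= q ^+ n.
  have [i1 <-] := killed_prod_independent t n.
  apply: ler_norm_Pint; [exact: (ib n).1|exact: i1.1|].
  by move=> w; exact: norm_killed_sum.
have x0 : x 0%N = 1.
  rewrite -[RHS](Pint_cst P); apply: eq_Rintegral => w _.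
  by rewrite /killed_sum /partial_sum !big_ord0 a0 mulr1.
have y0 : y 0%N = 0.
  rewrite -[RHS](Pint_cst P); apply: eq_Rintegral => w _.
  by rewrite /killed_sum /partial_sum !big_ord0 b0 mulr1.
pose U N := \sum_(n < N) x n; pose V N := \sum_(n < N) y n.
have UV N : U N * (1 - al) + V N * be = 1 - x N /\
    V N * (1 - al) - U N * be = - y N.
  elim: N => [|N [IH1 IH2]]; first by rewrite /U /V !big_ord0 x0 y0; split; ring.
  rewrite /U /V !big_ord_recr/= -/(U N) -/(V N) xS yS.
  split.
    transitivity ((U N * (1 - al) + V N * be) + x N * (1 - al) + y N * be); first by ring.
    by rewrite IH1; ring.
  transitivity ((V N * (1 - al) - U N * be) + y N * (1 - al) - x N * be); first by ring.
  by rewrite IH2; ring.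
have uU N : `|u - F * U N| <= q ^+ N by apply: Pint_passage_approx.
have vV N : `|v - F * V N| <= q ^+ N by apply: Pint_passage_approx.
(* Each conclusion has three error terms, each a quantity of size at most q^N times a factor of
   modulus at most 2; this is the constant 6 below. *)
have cb z r N : `|z| <= q ^+ N -> `|r| <= 2 -> `|z * r| <= 2 * q ^+ N.
  by move=> zq r2; rewrite normrM mulrC ler_pM.
have al2 : `|1 - al| <= 2.
  by rewrite (le_trans (ler_normB _ _))// normr1; lra.
have be2 : `|be| <= 2 by lra.
have F2 : `|F| <= 2 by rewrite ger0_norm; lra.
split; [apply/eqP; rewrite -subr_eq0; apply/eqP|];
  apply: (@eq0_le_expr R _ 6 q) => // N; have [E1 E2] := UV N.
- rewrite (_ : _ - F = (u - F * U N) * (1 - al) + (v - F * V N) * be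
      - x N * F); last first.
    transitivity ((u - F * U N) * (1 - al) + (v - F * V N) * be
      + F * (U N * (1 - al) + V N * be) - F); first by ring.
    by rewrite E1; ring.
  rewrite (le_trans (ler_normB _ _))// (_ :
    6 * q ^+ N = (2 * q ^+ N + 2 * q ^+ N) + 2 * q ^+ N); last by ring.
  by apply: lerD; [apply: (le_trans (ler_normD _ _)); apply: lerD|]; exact: cb.
- rewrite (_ : _ - u * be = (v - F * V N) * (1 - al) - (u - F * U N) * be
      - y N * F); last first.
    transitivity ((v - F * V N) * (1 - al) - (u - F * U N) * be
      + F * (V N * (1 - al) - U N * be)); first by ring.
    by rewrite E2; ring.
  rewrite (le_trans (ler_normB _ _))// (_ :
    6 * q ^+ N = (2 * q ^+ N + 2 * q ^+ N) + 2 * q ^+ N); last by ring.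
  by apply: lerD; [apply: (le_trans (ler_normB _ _)); apply: lerD|]; exact: cb.
Qed.

End character.

End killed_sums.

(** * Truncated means of variables with a power tail *)

Section truncated_mean.
Context (R : realType).

(** On a uniform mesh the increase of [A] is at most the left sum of [h], that of [B] at least the
    right sum, and the two sums differ by a telescoping quantity of order 1 / N. Later the truncated
    mean plays the part of [A] and of [B] in turn. *)
Lemma partition_compare (A B h : R -> R) (a b : R) : a <= b ->
  (forall x y, a <= x -> x <= y -> y <= b -> A y - A x <= h x * (y - x)) ->
  (forall x y, a <= x -> x <= y -> y <= b -> h y * (y - x) <= B y - B x) ->
  A b - A a <= B b - B a.
Proof.
move=> ab hA hB; pose z := (A b - A a) - (B b - B a).
pose D := (b - a) * (h a - h b).
have zD N : z <= D / N.+1%:R.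
  pose s := (b - a) / N.+1%:R; pose x (i : nat) := a + i%:R * s.
  have s0 : 0 <= s by rewrite divr_ge0// subr_ge0.
  have xi i : (i <= N.+1)%N -> (A (x i) - A a) - (B (x i) - B a) <= s * (h a - h (x i)).
    elim: i => [_|i IH iN]; first by rewrite /x mul0r addr0 !subrr mulr0.
    have ax : a <= x i by rewrite lerDl mulr_ge0.
    have xx : x i.+1 - x i = s by rewrite /x -natr1; ring.
    have xle : x i <= x i.+1 by rewrite -subr_ge0 xx.
    have xb : x i.+1 <= b.
      rewrite /x -lerBrDl (_ : b - a = N.+1%:R * s); last by rewrite /s mulrC divfK.
      by rewrite ler_wpM2r// ler_nat.
    have := hA _ _ ax xle xb; have := hB _ _ ax xle xb; rewrite xx.
    have := IH (ltnW iN); rewrite !mulrBr [h (x i) * _]mulrC [h (x i.+1) * _]mulrC; lra.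
  have xN : x N.+1 = b by rewrite /x /s mulrC divfK// subrKC.
  have := xi _ (leqnn _); rewrite xN -/z => /le_trans; apply.
  by rewrite /D /s mulrAC.
rewrite -subr_le0 -/z leNgt; apply/negP => z0.
have := zD (Num.truncn (D / z)); rewrite leNgt => /negP; apply.
by rewrite ltr_pdivrMr// mulrC -ltr_pdivrMr//; exact: truncnS_gt.
Qed.

Lemma derive_bracket (H h : R -> R) : (forall x : R, 0 < x -> is_derive x 1 H (h x)) ->
  (forall x y, 0 < x -> x <= y -> h y <= h x) ->
  forall x y, 0 < x -> x <= y ->
    h y * (y - x) <= H y - H x /\ H y - H x <= h x * (y - x).
Proof.
move=> dH hd x y x0 xy.
have [c] : exists2 c, c \in `[x, y]%R & H y - H x = h c * (y - x).
  apply: MVT_segment => // [z|].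
    by rewrite in_itv/= => /andP[xz _]; apply: dH; exact: lt_trans xz.
  apply: continuous_in_subspaceT => z; rewrite inE/= in_itv/= => /andP[xz _].
  have [dz _] := dH z (lt_le_trans x0 xz).
  by apply/differentiable_continuous/derivable1_diffP.
rewrite in_itv/= => /andP[xc cy] ->.
have c0 := lt_le_trans x0 xc.
by split; rewrite ler_wpM2r ?subr_ge0//; exact: hd.
Qed.

Context d (T : measurableType d) (P : probability T R) (V : T -> R).
Hypothesis mV : measurable_fun setT V.
Hypothesis V0 : forall w, 0 <= V w.

Definition tail (x : R) : R := \int[P]_w \1_`[x, +oo[ (V w).
(** For u >= 0 this is the integral of the tail over [0, u], written so that its increments can be
    bounded pointwise. *)
Definition tmean (u : R) : R := \int[P]_w Num.min (V w) u.

Lemma bounded_mfun_min u : bounded_mfun (fun w => Num.min (V w) u).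
Proof.
apply: (@bounded_mfunP _ _ _ _ `|u|); first exact: measurable_minr.
move=> w; have [Vu|uV] := leP (V w) u; last by [].
by rewrite ger0_norm// (le_trans Vu)// ler_norm.
Qed.

Lemma bounded_mfun_indic_comp (A : set R) : measurable A ->
  bounded_mfun (fun w => \1_A (V w) : R).
Proof. by move=> mA; exact: (bounded_mfun_comp (bounded_mfun_indic _ _)). Qed.

Lemma tail_ge0 x : 0 <= tail x.
Proof. by apply: Rintegral_ge0 => w _; rewrite indicE. Qed.

Lemma tmean_increment x y : x <= y ->
  tail y * (y - x) <= tmean y - tmean x /\ tmean y - tmean x <= tail x * (y - x).
Proof.
move=> xy; have yx : 0 <= y - x by rewrite subr_ge0.
have bI z : bounded_mfun (fun w => \1_`[z, +oo[ (V w) : R) by exact: bounded_mfun_indic_comp.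
have bc := @bounded_mfun_cst _ T R (y - x).
rewrite -!PintZr// -PintB; [|exact: bounded_mfun_min..].
split; apply: le_Pint; try (by apply: bounded_mfunM);
  try (by apply: bounded_mfunB; exact: bounded_mfun_min); move=> w; rewrite indicE.
- have [|_] := boolP (_ \in _).
    rewrite inE/= in_itv/= andbT mul1r => yV.
    by rewrite (min_idPr yV) (min_idPr (le_trans xy yV)).
  by rewrite mul0r subr_ge0 le_min ge_min lexx/= ge_min xy orbT.
- have [|] := boolP (_ \in _).
    rewrite inE/= in_itv/= andbT mul1r => xV.
    by rewrite (min_idPr xV) lerD2r ge_min lexx orbT.
  rewrite notin_setE/= in_itv/= andbT => /negP; rewrite -ltNge => Vx.
  by rewrite mul0r (min_idPl (ltW Vx)) (min_idPl (le_trans (ltW Vx) xy)) subrr.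
Qed.

(** An integration by parts: min(V, u) is V below level u and the constant u on the event measured
    by the tail. *)
Lemma tmean_trunc u : 0 <= u ->
  \int[P]_w (V w * \1_`[0, u[ (V w)) = tmean u - u * tail u.
Proof.
move=> u0; have bI : bounded_mfun (fun w => \1_`[u, +oo[ (V w) : R)
  by exact: bounded_mfun_indic_comp.
have bc := @bounded_mfun_cst _ T R u.
rewrite -PintZl// -PintB; [|exact: bounded_mfun_min|exact: bounded_mfunM].
apply: eq_Rintegral => w _; rewrite !indicE.
have [Vu|uV] := ltP (V w) u.
  rewrite mem_set/= ?in_itv/= ?V0// mulr1 memNset ?mulr0 ?subr0//.
  by rewrite /= in_itv/= andbT leNgt Vu.
rewrite memNset/= ?in_itv/= ?V0 ?ltNge ?uV// mulr0 mem_set/= ?in_itv/= ?uV//.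
by rewrite mulr1 subrr.
Qed.

Lemma tmean_nd x y : x <= y -> tmean x <= tmean y.
Proof.
move=> xy; rewrite -subr_ge0; apply: le_trans (tmean_increment xy).1.
by rewrite mulr_ge0 ?tail_ge0// subr_ge0.
Qed.

Context (h H : R -> R).
Hypothesis h_gt0 : forall x, 0 < x -> 0 < h x.
Hypothesis h_ni : forall x y, 0 < x -> x <= y -> h y <= h x.
Hypothesis dH : forall x : R, 0 < x -> is_derive x 1 H (h x).
Hypothesis tail_equiv : tail x / h x @[x --> +oo] --> (1 : R).

Lemma tmean_bracket e : 0 < e < 1 -> exists2 x0, 0 < x0 & forall u, x0 <= u ->
  (1 - e) * (H u - H x0) <= tmean u - tmean x0 /\
  tmean u - tmean x0 <= (1 + e) * (H u - H x0).
Proof.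
move=> /andP[e0 e1]; have br := derive_bracket dH h_ni.
have /cvgrPdist_le/(_ _ e0)[M [_ hM]] := tail_equiv.
(* This point is positive, as [h] and [H] require, and strictly beyond the threshold [M] of the tail
   equivalence. *)
exists (`|M| + 1); first by rewrite ltr_wpDl.
have hT (x : R) : `|M| + 1 <= x -> 0 < x /\ (1 - e) * h x <= tail x <= (1 + e) * h x.
  move=> Mx; have x0 : 0 < x by rewrite (lt_le_trans _ Mx)// ltr_wpDl.
  split=> //; have := hM x; rewrite (lt_le_trans _ Mx); last first.
    by rewrite (le_lt_trans (ler_norm _))// ltrDl.
  move=> /(_ isT) /=; rewrite ler_norml => /andP[h1 h2]; have h0 := h_gt0 x0.
  by apply/andP; split; [rewrite -ler_pdivlMr//; lra|rewrite -ler_pdivrMr//; lra].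
move=> u Mu; split.
  rewrite mulrBr.
  apply: (@partition_compare (fun x => (1 - e) * H x) tmean
    (fun x => (1 - e) * h x)) => // x y Mx xy yu.
    have [x0 _] := hT _ Mx; have [_ ?] := br _ _ x0 xy.
    by rewrite -mulrBr -mulrA ler_wpM2l// subr_ge0 ltW.
  apply: le_trans (tmean_increment xy).1.
  by rewrite ler_wpM2r ?subr_ge0//; have [_ /andP[]] := hT _ (le_trans Mx xy).
rewrite mulrBr.
apply: (@partition_compare tmean (fun x => (1 + e) * H x)
  (fun x => (1 + e) * h x)) => // x y Mx xy yu.
  apply: (le_trans (tmean_increment xy).2).
  by rewrite ler_wpM2r ?subr_ge0//; have [_ /andP[]] := hT _ Mx.
have [x0 _] := hT _ Mx; have [? _] := br _ _ x0 xy.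
by rewrite -mulrBr -mulrA ler_wpM2l// addr_ge0// ltW.
Qed.

(** The bracket holds up to constants attached to [x0], which a divergent primitive absorbs. *)
Lemma tmean_equiv : H x @[x --> +oo] --> +oo ->
  tmean u / H u @[u --> +oo] --> (1 : R).
Proof.
move=> Hy; apply/cvgrPdist_le => e e0.
(* The bound 1/2 keeps [e'] below 1, as the bracket requires; the bound e / 2 leaves the other half
   of the error to the constants at [x0]. *)
pose e' := Num.min (e / 2) (2^-1).
have e'0 : 0 < e' by rewrite /e' lt_min divr_gt0//= invr_gt0.
have e'1 : e' < 1 by rewrite /e' gt_min; apply/orP; right; lra.
have e'e : e' <= e / 2 by rewrite /e' ge_min lexx.
have [|x0 x00 hx] := @tmean_bracket e'; first by rewrite e'0.
pose C := `|H x0| + `|tmean x0 - H x0|.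
near=> u.
have xu : x0 <= u by near: u; apply: nbhs_pinfty_ge; exact: num_real.
(* The term 2 C / e brings the constants below (e / 2) H u; the term 1 makes H u positive. *)
have Hu : 1 + 2 * C / e <= H u by near: u; move/cvgryPge : Hy; apply.
have C0 : 0 <= C by rewrite addr_ge0.
have Hu0 : 0 < H u by rewrite (lt_le_trans _ Hu)// ltr_pwDl// divr_ge0 ?mulr_ge0// ltW.
have CH : C <= (e / 2) * H u.
  rewrite (_ : C = (e / 2) * (2 * C / e)); last by field; rewrite gt_eqF.
  rewrite ler_wpM2l//; first by rewrite ltW// divr_gt0.
  by rewrite (le_trans _ Hu)// lerDr.
have [h1 h2] := hx _ xu.
rewrite (_ : 1 - _ = (H u - tmean u) / H u); last by rewrite mulrBl divff// gt_eqF.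
rewrite normrM normfV [X in _ / X]gtr0_norm// ler_pdivrMr//.
have a1 := ler_norm (H x0); have a2 := ler_norm (- H x0).
have a3 := ler_norm (tmean x0 - H x0); have a4 := ler_norm (- (tmean x0 - H x0)).
rewrite !normrN in a2 a4.
have m1 : e' * H u <= e / 2 * H u by rewrite ler_wpM2r// ltW.
have m2 : `|e' * H x0| <= `|H x0|.
  by rewrite normrM ger0_norm ?(ltW e'0)// ler_piMl// ltW.
have m3 := ler_norm (e' * H x0); have m4 := ler_norm (- (e' * H x0)).
rewrite normrN in m4.
rewrite ler_norml; move: h1 h2 CH; rewrite /C !mulrBl !mulrBr !mulrDl !mul1r.
by move=> h1 h2 CH; apply/andP; split; lra.
Unshelve. all: by end_near. Qed.

(** Any fixed precision will do in the bracket, here 1/2; monotonicity covers the levels below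
    [x0]. *)
Lemma tmean_bounded B : (forall x, 0 < x -> H x <= B) ->
  exists C, forall u, tmean u <= C.
Proof.
move=> HB; have [|x0 x00 hx] := @tmean_bracket 2^-1; first by apply/andP; split; lra.
exists (tmean x0 + (1 + 2^-1) * (B - H x0)) => u.
have [xu|/ltW ux] := leP x0 u.
  have [_] := hx _ xu; rewrite lerBlDl => /le_trans; apply; rewrite lerD2l.
  apply: ler_wpM2l; first by lra.
  by rewrite lerD2r HB// (lt_le_trans x00).
by rewrite (le_trans (tmean_nd ux))// lerDl mulr_ge0// ?subr_ge0 ?HB//; lra.
Qed.

End truncated_mean.

(** * Powers and logarithm at infinity *)

Section power_functions.
Context (R : realType).

Lemma cvg_ln_pinfty : ln x @[x --> +oo] --> (+oo : set_system R).
Proof.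
apply/cvgryPge => A; near=> x.
have x0 : 0 < x by near: x; apply: nbhs_pinfty_gt; exact: num_real.
rewrite -ler_expR lnK//; near: x; apply: nbhs_pinfty_ge; exact: num_real.
Unshelve. all: by end_near. Qed.

Lemma cvg_powR_pinfty (a : R) : 0 < a -> x `^ a @[x --> +oo] --> (+oo : set_system R).
Proof.
move=> a0; apply/cvgryPge => A; near=> x.
have x0 : 0 < x by near: x; apply: nbhs_pinfty_gt; exact: num_real.
have Ax : Num.max 1 A `^ a^-1 <= x by near: x; apply: nbhs_pinfty_ge; exact: num_real.
have m0 : 0 <= Num.max 1 A by rewrite le_max ler01.
apply: (@le_trans _ _ (Num.max 1 A)); first by rewrite le_max lexx orbT.
rewrite [leLHS](_ : _ = (Num.max 1 A `^ a^-1) `^ a); last first.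
  by rewrite -powRrM mulVf ?gt_eqF// powRr1.
by apply: ge0_ler_powR; rewrite ?nnegrE ?powR_ge0// ltW.
Unshelve. all: by end_near. Qed.

Lemma powR_decreasing (b x y : R) : 0 <= b -> 0 < x -> x <= y -> y `^ (- b) <= x `^ (- b).
Proof.
move=> b0 x0 xy; rewrite !powRN lef_pV2 ?posrE ?powR_gt0//; last exact: lt_le_trans xy.
by apply: ge0_ler_powR; rewrite ?nnegrE//; [exact: ltW|exact: ltW (lt_le_trans x0 xy)].
Qed.

Lemma is_derive_power_primitive (c b x : R) : b != 1 -> 0 < x ->
  is_derive x 1 (fun x => c / (1 - b) * x `^ (1 - b)) (c * x `^ (- b)).
Proof.
move=> b1 x0; have dx := is_derive1_powR (1 - b) x0.
have := @is_deriveZ R R R (fun x => x `^ (1 - b)) (c / (1 - b)) x 1 _ dx.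
rewrite (_ : _ *: _ = c * x `^ (- b)) //.
rewrite /GRing.scale/= mulrA divfK ?subr_eq0 1?eq_sym//.
by congr (_ * _ `^ _); ring.
Qed.

Lemma is_derive_ln_primitive (c x : R) : 0 < x ->
  is_derive x 1 (fun x => c * ln x) (c * x `^ (- 1)).
Proof.
move=> x0; have dx := is_derive1_ln x0.
have := @is_deriveZ R R R (@ln R) c x 1 _ dx.
by rewrite /GRing.scale/= powR_inv1 ?ltW.
Qed.

End power_functions.

(** * Karamata's theorem for the truncated mean *)

Section power_tail.
Context (R : realType) d (T : measurableType d) (P : probability T R) (V : T -> R).
Hypothesis mV : measurable_fun setT V.
Hypothesis V0 : forall w, 0 <= V w.
Context (c b : R).
Hypothesis c0 : 0 < c.
Hypothesis b0 : 0 < b.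
Hypothesis tail_power : tail P V x / (c * x `^ (- b)) @[x --> +oo] --> (1 : R).

Let h (x : R) := c * x `^ (- b).

Let h_gt0 x : 0 < x -> 0 < h x.
Proof. by move=> x0; rewrite mulr_gt0// powR_gt0. Qed.

Let h_ni x y : 0 < x -> x <= y -> h y <= h x.
Proof. by move=> x0 xy; apply: ler_wpM2l; rewrite ?(ltW c0)//;
  exact: powR_decreasing (ltW b0) x0 xy. Qed.

(** The primitive c u^(1-b) / (1 - b) is asymptotic to u F(u) / (1 - b); removing the boundary term
    u F(u) subtracts 1 from the ratio and leaves b / (1 - b). *)
Lemma truncated_mean_ratio : b < 1 ->
  (\int[P]_w (V w * \1_`[0, u[ (V w))) / (u * tail P V u) @[u --> +oo] -->
  b / (1 - b).
Proof.
move=> b1; have b10 : 0 < 1 - b by rewrite subr_gt0.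
pose H (x : R) := c / (1 - b) * x `^ (1 - b).
have mH : tmean P V u / H u @[u --> +oo] --> (1 : R).
  apply: (tmean_equiv mV V0 h_gt0 h_ni) => //.
    by move=> x x0; apply: is_derive_power_primitive => //; rewrite lt_eqF.
  by apply: gt0_cvgMry; [rewrite divr_gt0|exact: cvg_powR_pinfty].
have hT : (tail P V x / h x)^-1 @[x --> +oo] --> (1 : R).
  by rewrite -[X in _ --> X]invr1; apply: cvgV => //; exact: oner_neq0.
have : tmean P V u / H u * (tail P V u / h u)^-1 * (1 - b)^-1 - 1 @[u --> +oo]
  --> 1 * 1 * (1 - b)^-1 - 1.
  by apply: cvgB; [apply: cvgM; [exact: cvgM|exact: cvg_cst]|exact: cvg_cst].
rewrite (_ : 1 * 1 * (1 - b)^-1 - 1 = b / (1 - b)); last by field; rewrite gt_eqF.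
apply: cvg_trans; apply: near_eq_cvg; near=> u.
have u0 : 0 < u by near: u; apply: nbhs_pinfty_gt; exact: num_real.
have T0 : 0 < tail P V u.
  have : 0 < tail P V u / h u by near: u; apply: (cvgr_gt _ tail_power); exact: ltr01.
  by rewrite pmulr_lgt0// invr_gt0 h_gt0.
rewrite tmean_trunc ?(ltW u0)// /H /h.
have -> : u `^ (1 - b) = u * u `^ (- b).
  by rewrite powRD ?powRr1 ?(ltW u0)// gt_eqF ?implybT.
have p0 : 0 < u `^ (- b) by rewrite powR_gt0.
by field; rewrite !gt_eqF.
Unshelve. all: by end_near. Qed.

(** Here E min(V, u) grows like c ln u while u F(u) tends to c: the boundary term is smaller by a
    factor ln u, and c cancels. This is why t log t carries no constant. *)
Lemma truncated_mean_log : b = 1 ->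
  (\int[P]_w (V w * \1_`[0, u[ (V w))) / (u * ln u * tail P V u) @[u --> +oo] -->
  (1 : R).
Proof.
move=> b1.
pose H (x : R) := c * ln x.
have mH : tmean P V u / H u @[u --> +oo] --> (1 : R).
  apply: (tmean_equiv mV V0 h_gt0 h_ni) => //.
    by move=> x x0; rewrite /h b1; exact: is_derive_ln_primitive.
  by apply: gt0_cvgMry => //; exact: cvg_ln_pinfty.
have hT : (tail P V x / h x)^-1 @[x --> +oo] --> (1 : R).
  by rewrite -[X in _ --> X]invr1; apply: cvgV => //; exact: oner_neq0.
have lV : (ln u)^-1 @[u --> +oo] --> (0 : R).
  apply/gtr0_cvgV0; last exact: cvg_ln_pinfty.
  by near=> u; apply: ln_gt0; near: u; apply: nbhs_pinfty_gt; exact: num_real.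
have : tmean P V u / H u * (tail P V u / h u)^-1 - (ln u)^-1 @[u --> +oo] --> (1 * 1 - 0 : R).
  by apply: cvgB => //; exact: cvgM.
rewrite mulr1 subr0.
apply: cvg_trans; apply: near_eq_cvg; near=> u.
have u1 : 1 < u by near: u; apply: nbhs_pinfty_gt; exact: num_real.
have u0 : 0 < u by exact: lt_trans u1.
have l0 : 0 < ln u by exact: ln_gt0.
have T0 : 0 < tail P V u.
  have : 0 < tail P V u / h u by near: u; apply: (cvgr_gt _ tail_power); exact: ltr01.
  by rewrite pmulr_lgt0// invr_gt0 h_gt0.
rewrite tmean_trunc ?(ltW u0)// /H /h b1 powR_inv1 ?(ltW u0)//.
by field; rewrite !gt_eqF.
Unshelve. all: by end_near. Qed.

(** For b > 1 the power primitive is negative on the positive half-line, hence the bound 0. *)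
Lemma tmean_bounded_power : 1 < b -> exists C, forall u, tmean P V u <= C.
Proof.
move=> b1; have b10 : 0 < b - 1 by rewrite subr_gt0.
apply: (tmean_bounded mV V0 h_gt0 h_ni (H := fun x =>
  c / (1 - b) * x `^ (1 - b)) _ tail_power (B := 0)).
  by move=> x x0; apply: is_derive_power_primitive => //; rewrite gt_eqF.
move=> x x0; rewrite -opprB invrN mulrN mulNr oppr_le0.
by apply: mulr_ge0; [apply: divr_ge0; exact: ltW|exact: powR_ge0].
Qed.

Lemma tail_mul_cvg0 : 1 < b -> u * tail P V u @[u --> +oo] --> (0 : R).
Proof.
move=> b1; have b10 : 0 < b - 1 by rewrite subr_gt0.
have pV : (u `^ (b - 1))^-1 @[u --> +oo] --> (0 : R).
  apply/gtr0_cvgV0; last exact: cvg_powR_pinfty.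
  by near=> u; rewrite powR_gt0//; near: u; apply: nbhs_pinfty_gt; exact: num_real.
have : tail P V u / h u * c * (u `^ (b - 1))^-1 @[u --> +oo] --> (1 * c * 0 : R).
  by apply: cvgM => //; apply: cvgM => //; exact: cvg_cst.
rewrite mulr0; apply: cvg_trans; apply: near_eq_cvg; near=> u.
have u0 : 0 < u by near: u; apply: nbhs_pinfty_gt; exact: num_real.
have -> : u `^ (b - 1) = u `^ b / u.
  by rewrite powRB ?powRr1 ?(ltW u0)// gt_eqF ?implybT.
rewrite /h powRN.
have p0 : 0 < u `^ b by rewrite powR_gt0.
by field; rewrite !gt_eqF.
Unshelve. all: by end_near. Qed.

End power_tail.

(** * Truncated moments of every order *)

Section truncated_moments.
Context (R : realType) d (T : measurableType d) (P : probability T R) (X : T -> R).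
Hypothesis mX : measurable_fun setT X.
Hypothesis X0 : forall w, 0 <= X w.
Context (c alpha : R).
Hypothesis c0 : 0 < c.
Hypothesis alpha0 : 0 < alpha.
Hypothesis tail_power : tail P X x / (c * x `^ (- alpha)) @[x --> +oo] --> (1 : R).

Lemma tail_expr n r : (0 < n)%N -> 0 <= r -> tail P (fun w => X w ^+ n) (r ^+ n) = tail P X r.
Proof.
move=> n0 r0; apply: eq_Rintegral => w _; rewrite !indicE; congr (_%:R); congr nat_of_bool.
apply/idP/idP; rewrite !inE/= !in_itv/= !andbT ler_pXn2r//; exact: X0.
Qed.

(** The variable X^n has a power tail of exponent alpha / n, still below 1, so the statement for
    means applies to it at u = t^n; with b = alpha / n the limit b / (1 - b) is alpha / (n -
    alpha). *)
Lemma truncated_moment_ratio n : (0 < n)%N -> alpha < 1 ->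
  (\int[P]_w (X w ^+ n * \1_`[0, t[ (X w))) / (t ^+ n * tail P X t) @[t --> +oo] -->
  alpha / (n%:R - alpha).
Proof.
move=> n0 a1.
have n0R : 0 < n%:R :> R by rewrite ltr0n.
have n1R : 1 <= n%:R :> R by rewrite ler1n.
pose V w := X w ^+ n.
have mV : measurable_fun setT V by exact: measurable_funX.
have V0 w : 0 <= V w by exact: exprn_ge0.
pose b := alpha / n%:R.
have b0 : 0 < b by rewrite divr_gt0.
have b1 : b < 1 by rewrite /b ltr_pdivrMr// mul1r (lt_le_trans a1).
have tV : tail P V x / (c * x `^ (- b)) @[x --> +oo] --> (1 : R).
  (* The tail of X^n at x is the tail of X at the n-th root of x. *)
  have root : x `^ n%:R^-1 @[x --> +oo] --> (+oo : set_system R).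
    by apply: cvg_powR_pinfty; rewrite invr_gt0.
  have := cvg_comp _ _ root tail_power.
  apply: cvg_trans; apply: near_eq_cvg; near=> x.
  have x0 : 0 < x by near: x; apply: nbhs_pinfty_gt; exact: num_real.
  rewrite /= -powRrM -(@tail_expr n)// ?powR_ge0//.
  rewrite -powR_mulrn ?powR_ge0// -powRrM mulVf ?gt_eqF// powRr1 ?(ltW x0)//.
  by rewrite mulrN [_^-1 * _]mulrC.
have pn : t ^+ n @[t --> +oo] --> (+oo : set_system R).
  have := cvg_powR_pinfty n0R; apply: cvg_trans; apply: near_eq_cvg; near=> t.
  by rewrite powR_mulrn//; near: t; apply: nbhs_pinfty_ge; exact: num_real.
have := cvg_comp _ _ pn (truncated_mean_ratio mV V0 c0 b0 tV b1).
rewrite (_ : b / (1 - b) = alpha / (n%:R - alpha)); last first.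
  rewrite /b; field; rewrite !gt_eqF//= subr_gt0.
  exact: lt_le_trans a1 _.
apply: cvg_trans; apply: near_eq_cvg; near=> t.
have t0 : 0 <= t by near: t; apply: nbhs_pinfty_ge; exact: num_real.
rewrite /= tail_expr//; congr (_ / _); apply: eq_Rintegral => w _; congr (_ * _).
rewrite !indicE; congr (_%:R); congr nat_of_bool; rewrite /V.
by apply/idP/idP; rewrite !inE/= !in_itv/= exprn_ge0 ?X0//= ltr_pXn2r// ?nnegrE.
Unshelve. all: by end_near. Qed.

End truncated_moments.

(** * Laplace transforms and bounded continuous functions *)

Section bernstein.
Context (R : realType).

(* Bernstein operator by recursion on the degree: [(bernstein n f).[u]] is the
   expectation of [f] at the number of successes in [n] trials of parameter [u]. *)
Fixpoint bernstein (n : nat) (f : nat -> R) : {poly R} :=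
  if n is n'.+1 then
    (1 - 'X) * bernstein n' f + 'X * bernstein n' (fun k => f k.+1)
  else (f 0%N)%:P.

Lemma bernsteinS n f u : (bernstein n.+1 f).[u] =
  (1 - u) * (bernstein n f).[u] + u * (bernstein n (fun k => f k.+1)).[u].
Proof. by rewrite /= !hornerE. Qed.

Lemma bernstein_le n f g u : 0 <= u <= 1 ->
  (forall k, (k <= n)%N -> f k <= g k) ->
  (bernstein n f).[u] <= (bernstein n g).[u].
Proof.
move=> /andP[u0 u1]; elim: n f g => [|n IH] f g fg; first by rewrite /= !hornerE fg.
rewrite !bernsteinS lerD// ler_wpM2l ?subr_ge0//; apply: IH => k kn.
  by rewrite fg// leqW.
exact: fg.
Qed.

Lemma bernstein_lin n f g a b u :
  (bernstein n (fun k => a * f k + b * g k)).[u] =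
  a * (bernstein n f).[u] + b * (bernstein n g).[u].
Proof.
elim: n f g => [|n IH] f g; first by rewrite /= !hornerE.
by rewrite !bernsteinS !IH; ring.
Qed.

Lemma bernstein_cst n c u : (bernstein n (fun=> c)).[u] = c.
Proof.
by elim: n => [|n IH]; [rewrite /= hornerE|rewrite bernsteinS IH; ring].
Qed.

(** The recursion shifts k by one, so the induction has to carry the shift c; the choice c = - n u
    then isolates the variance n u (1 - u). *)
Lemma bernstein_sqr n c u :
  (bernstein n (fun k => (k%:R + c) ^+ 2)).[u] =
  (n%:R * u + c) ^+ 2 + n%:R * u * (1 - u).
Proof.
elim: n c => [|n IH] c; first by rewrite /= hornerE; ring.
rewrite bernsteinS IH.
under [X in bernstein n X]eq_fun do rewrite -natr1 -addrA.
by rewrite IH -natr1; ring.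
Qed.

(** Compactness concerns [u] alone. Leaving [y] free on the line spares checking that the nodes k /
    n stay in the interval. *)
Lemma unif_continuous_itv (g : R -> R) (e : R) : continuous g -> 0 < e ->
  exists2 r : R, 0 < r & forall u y, 0 <= u <= 1 -> `|y - u| < r -> `|g u - g y| <= e.
Proof.
move=> cg e0.
have /compact_near_coveringP cov := @segment_compact R 0 1.
pose Q (r u : R) := forall y, `|y - u| < r -> `|g u - g y| <= e.
have : \forall r \near (0 : R)^'+, `[0, 1]%classic `<=` Q r.
  apply: cov => x _.
  have e20 : 0 < e / 2 by rewrite divr_gt0.
  have /cvgrPdist_lt/(_ _ e20)[r /= r0 gr] := cg x.
  have r20 : 0 < r / 2 by rewrite divr_gt0.
  exists (ball x (r / 2), [set s | 0 < s < r / 2]) => /=.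
    split; first exact: nbhsx_ballx.
    near=> s; apply/andP; split; near: s; first exact: nbhs_right_gt.
    exact: nbhs_right_lt.
  move=> [u s] /= [xu /andP[s0 sr]] y yu.
  have xu' : `|x - u| < r / 2 by exact: xu.
  have gu : `|g x - g u| < e / 2 by apply: gr => /=; lra.
  have gy : `|g x - g y| < e / 2.
    apply: gr => /=; rewrite (_ : x - y = (x - u) - (y - u)); last by ring.
    by rewrite (le_lt_trans (ler_normB _ _))//; lra.
  rewrite (_ : g u - g y = (g x - g y) - (g x - g u)); last by ring.
  by rewrite (le_trans (ler_normB _ _))//; lra.
move=> h; have [r [r0 rQ]] : exists r, 0 < r /\ (`[0, 1]%classic `<=` Q r).
  have [r] := @filter_ex _ ((0 : R)^'+) _ _ (filterI (nbhs_right_gt 0) h).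
  by case=> ? ?; exists r.
by exists r => // u y u01; apply: rQ; rewrite /= in_itv.
Unshelve. all: by end_near. Qed.

(** Chebyshev's argument: where y is far from u the oscillation, at most 2 C, is charged to a
    multiple of (y - u)^2, whose mean under the operator is the variance u (1 - u) / n. *)
Lemma bernstein_approx (g : R -> R) (C e : R) : continuous g ->
  (forall u, `|g u| <= C) -> 0 < e ->
  exists p : {poly R}, forall u, 0 <= u <= 1 -> `|g u - p.[u]| <= e.
Proof.
move=> cg gC e0.
have C0 : 0 <= C by exact: le_trans (normr_ge0 _) (gC 0).
have e20 : 0 < e / 2 by rewrite divr_gt0.
have [r r0 gr] := unif_continuous_itv cg e20.
pose D := 2 * C / r ^+ 2.
have D0 : 0 <= D by apply: divr_ge0; [exact: mulr_ge0|exact: sqr_ge0].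
have gq u y : 0 <= u <= 1 -> `|g u - g y| <= e / 2 + D * (y - u) ^+ 2.
  move=> u01; have [yr|ry] := ltP `|y - u| r.
    by rewrite (le_trans (gr _ _ u01 yr))// lerDl mulr_ge0// sqr_ge0.
  rewrite (le_trans (ler_normB _ _))// (@le_trans _ _ (2 * C))//.
    by have := gC u; have := gC y; lra.
  rewrite ler_wpDl ?(ltW e20)// /D mulrAC ler_pdivlMr ?exprn_gt0//.
  rewrite ler_wpM2l ?mulr_ge0// -[leRHS]ger0_norm ?sqr_ge0// normrX.
  by rewrite lerXn2r// ?nnegrE ?normr_ge0// ltW.
pose n := (Num.truncn (2 * D / e)).+1.
have n0 : 0 < n%:R :> R by [].
have nD : D / n%:R <= e / 2.
  rewrite ler_pdivrMr// -ler_pdivrMl// (_ : _ * D = 2 * D / e).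
    exact/ltW/truncnS_gt.
  by field; rewrite gt_eqF.
exists (bernstein n (fun k => g (k%:R / n%:R))) => u u01.
(* The sign [s] settles both one-sided bounds at once, since [bernstein_le] compares in one
   direction. *)
have key s : s = 1 \/ s = -1 -> s * g u - s * (bernstein n (fun k => g (k%:R / n%:R))).[u] <= e.
  move=> s1.
  have -> : s * g u - s * (bernstein n (fun k => g (k%:R / n%:R))).[u] =
      (bernstein n (fun k => 1 * (s * g u) + - s * g (k%:R / n%:R))).[u].
    by rewrite bernstein_lin bernstein_cst; ring.
  apply: (@le_trans _ _ (bernstein n (fun k =>
    (e / 2) * 1 + (D / n%:R ^+ 2) * (k%:R + - (n%:R * u)) ^+ 2)).[u]).
    apply: bernstein_le => // k kn.
    rewrite mul1r mulNr -mulrBr mulr1.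
    apply: (@le_trans _ _ (`|g u - g (k%:R / n%:R)|)).
      by case: s1 => ->; rewrite ?mul1r ?mulN1r ?ler_norm// -normrN ler_norm.
    rewrite (le_trans (gq _ _ u01))// lerD2l.
    rewrite le_eqVlt; apply/orP; left; apply/eqP; field.
    by rewrite gt_eqF.
  rewrite bernstein_lin bernstein_cst bernstein_sqr mulr1 subrr.
  have H : D / n%:R ^+ 2 * (0 ^+ 2 + n%:R * u * (1 - u)) <= e / 2.
    rewrite (le_trans _ nD)// (_ : _ * _ = D / n%:R * (u * (1 - u))); last first.
      by field; rewrite gt_eqF.
    move: u01 => /andP[? ?]; apply: ler_piMr; first exact: divr_ge0 D0 (ltW n0).
    by rewrite mulr_ile1//; lra.
  by apply: (le_trans (lerD (lexx _) H)); lra.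
rewrite ler_norml; have := key 1 (or_introl erefl); have := key (-1) (or_intror erefl).
by rewrite !mulN1r !mul1r; lra.
Qed.

(** The function f(- ln u) may have no limit at u = 0, so the logarithm is frozen below exp(- M).
    Only points beyond M see the change, and each pays at most 2 C. *)
Lemma laplace_poly_approx (f : R -> R) (C M e : R) : continuous f ->
  (forall x, `|f x| <= C) -> 0 < e ->
  exists p : {poly R}, forall x, 0 <= x ->
    `|f x - p.[expR (- x)]| <= e + 2 * C * \1_`]M, +oo[ x.
Proof.
move=> cf fC e0.
pose g u := f (- ln (Num.max u (expR (- M)))).
have cg : continuous g.
  move=> u; apply: continuous_comp; last exact: cf.
  apply: continuousN; apply: continuous_comp; last first.
    by apply: continuous_ln; rewrite lt_max expR_gt0 orbT.
  by apply: continuous_max; [exact: cvg_id|exact: cvg_cst].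
have [p pe] := bernstein_approx cg (fun u => fC _) e0.
exists p => x x0.
have /pe : 0 <= expR (- x) <= 1 by rewrite expR_ge0 -expR0 ler_expR oppr_le0.
have [xM|Mx] := leP x M.
  rewrite /g (max_idPl _) ?ler_expR ?lerN2// expRK opprK.
  by rewrite indicE memNset ?mulr0 ?addr0//= in_itv/= andbT ltNge xM.
rewrite indicE mem_set/= ?in_itv/= ?Mx// mulr1 => pg.
rewrite (_ : _ - _ = (g (expR (- x)) - p.[expR (- x)]) + (f x - g (expR (- x)))); last by ring.
rewrite (le_trans (ler_normD _ _))// lerD// (le_trans (ler_normB _ _))//.
by have := fC x; have := fC (- ln (Num.max (expR (- x)) (expR (- M)))); rewrite -/(g _); lra.
Qed.

End bernstein.

(** * Tightness and comparison through Laplace transforms *)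

Section laplace_compare.
Context (R : realType).

(** A mean at most K would imply this, but the condition involves the transform alone, which is the
    quantity that the passage identity computes. *)
Definition laplace_tight d (T : measurableType d) (P : probability T R)
    (K : R) (Z : T -> R) :=
  forall l, 0 < l -> 1 - \int[P]_w expR (- (l * Z w)) <= K * l.

Section one_variable.
Context d (T : measurableType d) (P : probability T R) (Z : T -> R).
Hypothesis mZ : measurable_fun setT Z.
Hypothesis Z0 : forall w, 0 <= Z w.

Lemma bounded_mfun_expRN l : 0 <= l -> bounded_mfun (fun w => expR (- (l * Z w))).
Proof.
move=> l0; apply: (@bounded_mfunP _ _ _ _ 1).
  apply: measurableT_comp => //; apply: measurableT_comp => //.
  exact: measurable_funM.
by move=> w; rewrite ger0_norm ?expR_ge0// -expR0 ler_expR oppr_le0 mulr_ge0.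
Qed.

Lemma bounded_mfun_continuous_comp (f : R -> R) C : continuous f ->
  (forall x, `|f x| <= C) -> bounded_mfun (fun w => f (Z w)).
Proof.
move=> cf fC; apply: (@bounded_mfunP _ _ _ _ C) => //.
by apply: measurableT_comp => //; exact: continuous_measurable_fun.
Qed.

(** At l = 1 / M the integrand 1 - exp(- Z / M) is at least 1/2 beyond M, because exp(- 1) is at
    most 1/2; hence the factor 2. *)
Lemma laplace_tail K M : laplace_tight P K Z -> 0 < M ->
  \int[P]_w \1_`]M, +oo[ (Z w) <= 2 * K / M.
Proof.
move=> tZ M0.
have l0 : 0 < M^-1 by rewrite invr_gt0.
have b1 := @bounded_mfun_cst _ T R 1.
have bE := bounded_mfun_expRN (ltW l0).
have bI : bounded_mfun (fun w => \1_`]M, +oo[ (Z w) : R).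
  exact: (bounded_mfun_comp (bounded_mfun_indic _ _)).
apply: (@le_trans _ _ (\int[P]_w (2 * (1 - expR (- (M^-1 * Z w)))))).
  apply: le_Pint => //.
    by apply: bounded_mfunM; [exact: bounded_mfun_cst|exact: bounded_mfunB].
  move=> w; rewrite indicE; have [|_] := boolP (Z w \in _); last first.
    by rewrite mulr_ge0// subr_ge0 -expR0 ler_expR oppr_le0 mulr_ge0// ltW.
  rewrite inE/= in_itv/= andbT => MZ.
  have e1 : expR (- (M^-1 * Z w)) <= 2^-1.
    apply: (@le_trans _ _ (expR (- 1))).
      by rewrite ler_expR lerN2 mulrC ler_pdivlMr// mul1r ltW.
    by rewrite expRN lef_pV2 ?posrE ?expR_gt0//; have := expR_ge1Dx (1 : R).
  by rewrite mulr1n; lra.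
have := tZ _ l0.
rewrite PintZl; last exact: bounded_mfunB.
rewrite PintB// Pint_cst -mulrA => H.
by rewrite ler_pM2l.
Qed.

Lemma Pint_poly_expRN (p : {poly R}) :
  \int[P]_w p.[expR (- Z w)] =
  \sum_(k < size p) p`_k * \int[P]_w expR (- (k%:R * Z w)).
Proof.
have bE k : bounded_mfun (fun w => expR (- (k%:R * Z w))) by exact: bounded_mfun_expRN.
have bpE k : bounded_mfun (fun w => p`_k * expR (- (k%:R * Z w))).
  by apply: bounded_mfunM => //; exact: bounded_mfun_cst.
transitivity (\int[P]_w \sum_(k < size p) p`_k * expR (- (k%:R * Z w))).
  apply: eq_Rintegral => w _; rewrite horner_coef; apply: eq_bigr => k _.
  by rewrite -expRM_natl mulrN.
by rewrite (Pint_sum _ _ (F := fun (k : 'I_(size p)) w => p`_k * expR (- (k%:R * Z w))))//;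
  apply: eq_bigr => k _; rewrite PintZl.
Qed.

Lemma bounded_mfun_poly_expRN (p : {poly R}) : bounded_mfun (fun w => p.[expR (- Z w)]).
Proof.
rewrite (_ : (fun w => _) = fun w => \sum_(k < size p) p`_k * expR (- (k%:R * Z w))).
  apply: bounded_mfun_sum => k; apply: bounded_mfunM; first exact: bounded_mfun_cst.
  exact: bounded_mfun_expRN.
apply/funext => w; rewrite horner_coef; apply: eq_bigr => k _.
by rewrite -expRM_natl mulrN.
Qed.

Lemma Pint_laplace_poly_approx (f : R -> R) (C K M e : R) (p : {poly R}) :
  continuous f -> (forall x, `|f x| <= C) -> laplace_tight P K Z -> 0 < M ->
  (forall x, 0 <= x -> `|f x - p.[expR (- x)]| <= e + 2 * C * \1_`]M, +oo[ x) ->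
  `|\int[P]_w f (Z w) - \int[P]_w p.[expR (- Z w)]| <= e + 2 * C * (2 * K / M).
Proof.
move=> cf fC tZ M0 fp.
have C0 : 0 <= C by exact: le_trans (normr_ge0 _) (fC 0).
have bf := bounded_mfun_continuous_comp cf fC.
have bp := bounded_mfun_poly_expRN p.
have bI : bounded_mfun (fun w => \1_`]M, +oo[ (Z w) : R).
  exact: (bounded_mfun_comp (bounded_mfun_indic _ _)).
have be := @bounded_mfun_cst _ T R e; have bC := @bounded_mfun_cst _ T R (2 * C).
rewrite -PintB//.
apply: (@le_trans _ _ (\int[P]_w (e + 2 * C * \1_`]M, +oo[ (Z w)))).
  apply: ler_norm_Pint; [exact: bounded_mfunB| |by move=> w; exact: fp].
  by apply: bounded_mfunD => //; exact: bounded_mfunM.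
rewrite PintD//; last exact: bounded_mfunM.
rewrite Pint_cst PintZl// lerD2l ler_wpM2l ?mulr_ge0//.
exact: laplace_tail.
Qed.

End one_variable.

(* Quantitative continuity theorem: finitely many values of the Laplace
   transform control the integral of a bounded continuous function. *)
Lemma laplace_compare (f : R -> R) (C K e : R) : continuous f ->
  (forall x, `|f x| <= C) -> 0 < e ->
  exists (N : nat) (r : R), 0 < r /\
  forall d1 (T1 : measurableType d1) (P1 : probability T1 R) (Z1 : T1 -> R)
         d2 (T2 : measurableType d2) (P2 : probability T2 R) (Z2 : T2 -> R),
  measurable_fun setT Z1 -> (forall w, 0 <= Z1 w) -> laplace_tight P1 K Z1 ->
  measurable_fun setT Z2 -> (forall w, 0 <= Z2 w) -> laplace_tight P2 K Z2 ->
  (forall k, (k < N)%N -> `|\int[P1]_w expR (- (k%:R * Z1 w)) -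
                  \int[P2]_w expR (- (k%:R * Z2 w))| <= r) ->
  `|\int[P1]_w f (Z1 w) - \int[P2]_w f (Z2 w)| <= e.
Proof.
move=> cf fC e0.
have C0 : 0 <= C by exact: le_trans (normr_ge0 _) (fC 0).
(* The choice of [M] makes each tail term at most e / 6. Both replacements of [f] by the polynomial
   then cost at most e / 3, and the coefficients of the polynomial, summed in [S], cost e / 6
   more. *)
pose D := 1 + 4 * C * `|K|.
have D0 : 0 < D by rewrite /D ltr_pwDl// !mulr_ge0.
pose M := 6 * D / e.
have M0 : 0 < M by rewrite divr_gt0 ?mulr_gt0.
have e60 : 0 < e / 6 by rewrite divr_gt0.
have [p fp] := laplace_poly_approx M cf fC e60.
pose S := \sum_(k < size p) `|p`_k|.
have S0 : 0 <= S by exact: sumr_ge0.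
exists (size p), ((e / 6) / (1 + S)); split; first by rewrite divr_gt0// ltr_pwDl.
move=> d1 T1 P1 Z1 d2 T2 P2 Z2 mZ1 Z10 tZ1 mZ2 Z20 tZ2 PZ.
have hM : 2 * C * (2 * K / M) <= e / 6.
  apply: (@le_trans _ _ (D / M)); last first.
    rewrite le_eqVlt; apply/orP; left; apply/eqP; rewrite /M; field.
    by rewrite !gt_eqF.
  rewrite (_ : 2 * C * _ = (4 * C * K) / M); last by ring.
  rewrite ler_pM2r ?invr_gt0// /D (@le_trans _ _ (4 * C * `|K|))// ?lerDr//.
  by rewrite ler_wpM2l ?mulr_ge0// ler_norm.
have h1 := Pint_laplace_poly_approx mZ1 Z10 cf fC tZ1 M0 fp.
have h2 := Pint_laplace_poly_approx mZ2 Z20 cf fC tZ2 M0 fp.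
have h12 : `|\int[P1]_w p.[expR (- Z1 w)] - \int[P2]_w p.[expR (- Z2 w)]| <= e / 6.
  rewrite !Pint_poly_expRN// -sumrB.
  apply: (@le_trans _ _ (\sum_(k < size p) `|p`_k| * ((e / 6) / (1 + S)))).
    apply: (le_trans (ler_norm_sum _ _ _)); apply: ler_sum => k _.
    by rewrite -mulrBr normrM ler_wpM2l// PZ.
  rewrite -mulr_suml -/S mulrCA ger_pMr// ler_pdivrMr ?mul1r ?lerDr//.
  by rewrite ltr_pwDl.
set i1 := \int[P1]_w f (Z1 w) in h1 *; set i2 := \int[P2]_w f (Z2 w) in h2 *.
set j1 := \int[P1]_w p.[_] in h1 h12; set j2 := \int[P2]_w p.[_] in h2 h12.
rewrite (_ : i1 - i2 = (i1 - j1) + (j1 - j2) - (i2 - j2)); last by ring.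
rewrite (le_trans (ler_normB _ _))//.
by have := ler_normD (i1 - j1) (j1 - j2); lra.
Qed.

End laplace_compare.

(** * Existence of limit laws *)

Section quantile.
Context (R : realType) (G : R -> R).
Hypothesis G_nd : nondecreasing_fun G.
Hypothesis G_rc : right_continuous G.
Hypothesis G_neg : forall x, x < 0 -> G x = 0.
Hypothesis G_lim1 : forall p, p < 1 -> exists x, p <= G x.

Definition quantile (p : R) : R := inf [set x | p <= G x].

Lemma quantile_lbound p : 0 < p -> lbound [set x | p <= G x] 0.
Proof.
by move=> p0 x /=; rewrite leNgt => pG; rewrite leNgt; apply: contra pG => /G_neg ->.
Qed.

Lemma quantile_ge0 p : 0 < p < 1 -> 0 <= quantile p.
Proof.
move=> /andP[p0 p1]; apply: lb_le_inf; last exact: quantile_lbound.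
by have [x px] := G_lim1 p1; exists x.
Qed.

(** Right continuity puts the infimum itself in the set, which makes the quantile the lower adjoint
    of [G]. *)
Lemma quantile_le p x : 0 < p < 1 -> (quantile p <= x) = (p <= G x).
Proof.
move=> /andP[p0 p1]; apply/idP/idP => [qx|px]; last first.
  by apply: ge_inf => //; exists 0; exact: quantile_lbound.
apply: le_trans (G_nd qx).
have GQ : G y @[y --> (quantile p)^'+] --> G (quantile p) by exact: G_rc.
rewrite -(cvg_lim (@Rhausdorff R) GQ); apply: limr_ge; first by apply/cvg_ex; eexists; exact: GQ.
near=> y.
have qy : quantile p < y by near: y; exact: nbhs_right_gt.
have [z /= pz zy] : exists2 z, [set x | p <= G x] z & z < y.
  by apply: inf_lt => //; have [z pz] := G_lim1 p1; exists z.
by rewrite (le_trans pz)// G_nd// ltW.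
Unshelve. all: by end_near. Qed.

(** By adjunction the quantile is nondecreasing, so its superlevel sets are intervals. *)
Lemma measurable_quantile : measurable_fun (`]0, 1[ : set R) quantile.
Proof.
apply: (measurability (@RGenCInfty.G R)) => [|/= _ [_] [r] -> <-].
  exact: RGenCInfty.measurableE.
apply: is_interval_measurable => s t/=; rewrite !in_itv/= !andbT.
move=> [s01 rs] [t01 rt] u /andP[su ut].
have u01 : 0 < u < 1.
  by move: s01 t01 => /andP[s0 _] /andP[_ t1]; rewrite (lt_le_trans s0)//= (le_lt_trans ut).
rewrite in_itv/= u01 in_itv/= andbT; split => //.
by rewrite (le_trans rs)// quantile_le// (le_trans su)// -quantile_le.
Qed.

End quantile.

Lemma probability_eq_rays (R : realType) (mu nu : probability (measurableTypeR R) R) :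
  (forall x, mu `]x, +oo[%classic = nu `]x, +oo[%classic) ->
  forall A, measurable A -> mu A = nu A.
Proof.
move=> munu A mA.
apply: (@measure_unique _ R (measurableTypeR R) (@RGenOInfty.G R)
  (fun k => `](- k%:R), +oo[%classic)) => //.
- exact: RGenOInfty.measurableE.
- move=> _ _ [x ->] [y ->]; exists (Num.max x y).
  apply/seteqP; split => z /=; rewrite !in_itv/= !andbT gt_max.
    by move=> [-> ->].
  by move=> /andP[].
- by move=> k; exists (- k%:R).
- apply/seteqP; split => // z _; exists (Num.truncn `|z|).+1 => //=.
  rewrite in_itv/= andbT ltrNl (le_lt_trans (ler_norm _))// normrN.
  exact: truncnS_gt.
- by move=> _ [x ->]; exact: munu.
- by move=> k; rewrite (le_lt_trans (probability_le1 _ _)) ?ltry.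
Qed.

Lemma Pint_dominated_cvg (R : realType) d (T : measurableType d)
    (P : probability T R) (F : nat -> T -> R) (f : T -> R) (C : R) :
  (forall n, measurable_fun setT (F n)) -> measurable_fun setT f ->
  (forall n w, `|F n w| <= C) -> (forall w, F n w @[n --> \oo] --> f w) ->
  \int[P]_w F n w @[n --> \oo] --> \int[P]_w f w.
Proof.
move=> mF mf FC Ff.
have [] := @dominated_convergence _ T R P setT measurableT
  (fun n w => (F n w)%:E) (fun w => (f w)%:E) (fun=> C%:E).
- by move=> n; exact/measurable_EFinP.
- exact/measurable_EFinP.
- by apply: aeW => w _; apply: cvg_EFin; [exact: nearW|exact: Ff].
- exact: bounded_mfun_integrable (bounded_mfun_cst _ _).
- by apply: aeW => w n _; rewrite abse_EFin lee_fin.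
move=> fi _ cF.
have fin : (\int[P]_w (f w)%:E)%E \is a fin_num by exact: integrable_fin_num.
by apply: fine_cvg; rewrite /Rintegral fineK.
Qed.

Section law.
Context (R : realType) d (T : measurableType d) (P : probability T R).
Variables (Y : T -> measurableTypeR R) (mY : measurable_fun setT Y).

Definition law : probability (measurableTypeR R) R :=
  distribution P (mfun_Sub (mem_set mY) : {mfun T >-> measurableTypeR R}).

Lemma lawE (A : set R) : law A = P (Y @^-1` A).
Proof. by []. Qed.

Lemma Pint_law (f : R -> R) : bounded_mfun f ->
  \int[law]_x f x = \int[P]_w f (Y w).
Proof.
move=> bf; rewrite /Rintegral /law integral_distribution//.
  by apply/measurable_EFinP; exact: bf.1.
apply: bounded_mfun_integrable; exact: (bounded_mfun_comp bf).
Qed.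

End law.

Section unit_interval_prob.
Context (R : realType).

(** The ends are left out: for a distribution function the set defining the quantile is unbounded
    below at level 0 and may be empty at level 1. *)
Definition unit_interval_prob : set (measurableTypeR R) -> \bar R :=
  mrestr (@lebesgue_measure R) (measurable_itv (`]0, 1[ : interval R)).

HB.instance Definition _ := Measure.on unit_interval_prob.

Let unit_interval_prob_setT : unit_interval_prob setT = 1%E.
Proof.
by rewrite /unit_interval_prob /mrestr setTI lebesgue_measure_itv/= lte_fin ltr01 sube0.
Qed.

HB.instance Definition _ := @Measure_isProbability.Build _ _ R
  unit_interval_prob unit_interval_prob_setT.

Lemma unit_interval_probE (A : set R) :
  unit_interval_prob A = @lebesgue_measure R (A `&` `]0, 1[%classic).
Proof. by []. Qed.

End unit_interval_prob.

(** * Construction of a limit law from quantile functions *)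

Section limit_law.
Context (R : realType) d (T : measurableType d) (P : probability T R).
Context (Z : nat -> {RV P >-> R}) (K : R).
Hypothesis Z_ge0 : forall n w, 0 <= Z n w.
Hypothesis Z_tail : forall n M, 0 < M -> \int[P]_w \1_`]M, +oo[ (Z n w) <= K / M.
Hypothesis Z_cvg : forall f : R -> R, continuous f -> bounded_fun f ->
  cvgn (fun n => \int[P]_w f (Z n w)).

Let G n x := \int[P]_w \1_`]-oo, x] (Z n w) : R.

Let bZ n (A : set R) : measurable A -> bounded_mfun (fun w => \1_A (Z n w) : R).
Proof. by move=> mA; exact: (bounded_mfun_comp (bounded_mfun_indic _ _)). Qed.

Let GE n x : G n x = fine (cdf (Z n) x).
Proof. rewrite /G /cdf /distribution/= /pushforward/= -Pint_indic//.
by rewrite -[X in measurable X]setTI; exact: (measurable_funPT (Z n)). Qed.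

Let G_nd n : nondecreasing_fun (G n).
Proof.
by move=> x y xy; rewrite !GE fine_le ?fin_num_measure// cdf_nondecreasing.
Qed.

Let G_rc n : right_continuous (G n).
Proof.
move=> a; rewrite GE (_ : G n = fine \o cdf (Z n)); last exact/funext/GE.
by apply: fine_cvg; rewrite fineK ?fin_num_measure//; exact: cdf_right_continuous.
Qed.

Let G_neg n x : x < 0 -> G n x = 0.
Proof.
move=> x0; rewrite -[RHS](Pint_cst P); apply: eq_Rintegral => w _.
by rewrite indicE memNset//= in_itv/= leNgt (lt_le_trans x0).
Qed.

Let G_tail n x : 1 - G n x = \int[P]_w \1_`]x, +oo[ (Z n w).
Proof.
rewrite -(Pint_cst P 1) -PintB; [|exact: bounded_mfun_cst|exact: bZ].
apply: eq_Rintegral => w _; rewrite !indicE.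
have [wx|xw] := leP (Z n w) x.
  by rewrite mem_set ?memNset ?subrr//= in_itv/= ?wx// ltNge wx.
by rewrite memNset ?mem_set ?subr0//= in_itv/= ?xw// leNgt xw.
Qed.

Let G_le1 n p : p < 1 -> p <= G n (`|K| / (1 - p) + 1).
Proof.
move=> p1; have q0 : 0 < 1 - p by rewrite subr_gt0.
have M0 : 0 < `|K| / (1 - p) + 1 by rewrite ltr_wpDl// divr_ge0// ltW.
suff : 1 - G n (`|K| / (1 - p) + 1) <= 1 - p by lra.
rewrite G_tail (le_trans (Z_tail _ M0))// ler_pdivrMr// mulrDr mulr1.
rewrite [_ * (_ / _)]mulrCA divff ?gt_eqF// mulr1.
by rewrite (le_trans (ler_norm _))// lerDl ltW.
Qed.

Let G_lim1 n p : p < 1 -> exists x, p <= G n x.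
Proof. by move=> p1; exists (`|K| / (1 - p) + 1); exact: G_le1. Qed.

Let Q n := quantile (G n).

Let Q_le n p x : 0 < p < 1 -> (Q n p <= x) = (p <= G n x).
Proof. exact: (quantile_le (@G_nd n) (@G_rc n) (@G_neg n) (@G_lim1 n)). Qed.

(** For a < b this lies between the indicators of the half-lines up to a and up to b. It links the
    quantiles, governed by [G], to the convergence hypothesis, which speaks of continuous
    functions. *)
Let ramp (a b x : R) := Num.max 0 (Num.min 1 ((b - x) / (b - a))).

Let ramp_itv a b x : 0 <= ramp a b x <= 1.
Proof. by rewrite /ramp le_max lexx/= ge_max ler01 ge_min lexx. Qed.

Let continuous_ramp a b : continuous (ramp a b).
Proof.
move=> x; apply: (@continuous_max R R (fun=> 0) (fun x =>
  Num.min 1 ((b - x) / (b - a)))); first exact: cvg_cst.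
apply: continuous_min; first exact: cvg_cst.
apply: cvgM; last exact: cvg_cst.
by apply: cvgB; [exact: cvg_cst|exact: cvg_id].
Qed.

Let bounded_ramp a b : bounded_fun (ramp a b).
Proof.
exists 1; split; first exact: num_real.
move=> x x1 y _; have /andP[r0 r1] := ramp_itv a b y.
by rewrite /= ger0_norm// (le_trans r1)// ltW.
Qed.

Let bramp n a b : bounded_mfun (fun w => ramp a b (Z n w)).
Proof.
apply: (@bounded_mfunP _ _ _ _ 1) => [|w].
  by apply: measurableT_comp => //; apply: continuous_measurable_fun; exact: continuous_ramp.
by have /andP[r0 r1] := ramp_itv a b (Z n w); rewrite ger0_norm.
Qed.

Let G_ramp n a b : a < b -> G n a <= \int[P]_w ramp a b (Z n w) <= G n b.
Proof.
move=> ab; have ba : 0 < b - a by rewrite subr_gt0.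
apply/andP; split; apply: le_Pint; try exact: bZ; try exact: bramp; move=> w; rewrite indicE.
  have [|_] := boolP (_ \in _); last by have /andP[] := ramp_itv a b (Z n w).
  rewrite inE/= in_itv/= => wa; rewrite /ramp le_max le_min lexx/=.
  by rewrite ler_pdivlMr// mul1r lerD2l lerN2 wa orbT.
have [|] := boolP (_ \in _); first by have /andP[] := ramp_itv a b (Z n w).
rewrite notin_setE/= in_itv/= => /negP; rewrite -ltNge => bw.
by rewrite /ramp ge_max lexx/= ge_min pmulr_lle0 ?invr_gt0// subr_le0 (ltW bw) orbT.
Qed.

Let L a b := limn (fun n => \int[P]_w ramp a b (Z n w)).

Let rampL a b : \int[P]_w ramp a b (Z n w) @[n --> \oo] --> L a b.
Proof. by apply: Z_cvg; [exact: continuous_ramp|exact: bounded_ramp]. Qed.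

(* Levels at which the quantile functions may fail to converge. *)
Let bad : set R := [set p | exists a b : rat, p = L (ratr a) (ratr b)].

Let countable_bad : countable bad.
Proof.
rewrite (_ : bad = (fun ab : rat * rat => L (ratr ab.1) (ratr ab.2)) @` setT).
  exact: card_le_trans (card_image_le _ _) (countableP _).
apply/seteqP; split => p /=; first by move=> [a [b ->]]; exists (a, b).
by move=> [[a b] _ <-]; exists a, b.
Qed.

(** The limit is the upper limit, written as the infimum of the eventual upper bounds. If the
    sequence kept dropping below it by e, two rationals a < c would fit in the gap: values above c
    force L a c <= p, values at most a force p <= L a c, so p would be bad. *)
Let cvg_quantile p : 0 < p < 1 -> ~ bad p -> cvgn (fun n => Q n p).
Proof.
move=> p01 pbad.
have [p0 p1] := andP p01.
pose A := [set b : R | \forall n \near \oo, Q n p <= b].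
have A0 : A !=set0.
  exists (`|K| / (1 - p) + 1); apply: nearW => n.
  by rewrite Q_le// G_le1.
have lA : lbound A 0.
  move=> b [N _ /(_ N (leqnn N))] /=; apply: le_trans.
  exact: (quantile_ge0 (@G_neg N) (@G_lim1 N)).
apply/cvg_ex; exists (inf A); apply/cvgrPdist_le => e e0.
have [b Ab be] : exists2 b, A b & b < inf A + e by apply: inf_lt; rewrite ?ltrDl.
have e0' : inf A - e < inf A by rewrite ltrBlDr ltrDl.
have [c] := rat_in_itvoo e0'; rewrite in_itv/= => /andP[ec cA].
have [a] := rat_in_itvoo ec; rewrite in_itv/= => /andP[ea ac].
have freq : forall N : nat, exists2 n, (N <= n)%N & ratr c < Q n p.
  move=> N; apply: contrapT => H.
  suff : A (ratr c) by move=> /(ge_inf (ex_intro _ 0 lA)); rewrite leNgt cA.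
  exists N => // n Nn; rewrite /= leNgt; apply/negP => cQ; apply: H; by exists n.
have Lp : L (ratr a) (ratr c) <= p.
  rewrite leNgt; apply/negP => pL.
  have [N _ HN] := cvgr_gt _ (@rampL (ratr a) (ratr c)) _ pL.
  have [n Nn] := freq N; rewrite ltNge Q_le// => /negP; apply.
  have /andP[_ h] := G_ramp n ac; apply: le_trans h.
  by apply: ltW; exact: HN.
have evA : \forall n \near \oo, ratr a < Q n p.
  apply: contrapT => H; apply: pbad; exists a, c; apply/eqP.
  rewrite eq_le Lp andbT leNgt; apply/negP => Lp'.
  apply: H; near=> n; rewrite ltNge Q_le// -ltNge.
  have /andP[h _] := G_ramp n ac; apply: le_lt_trans h _.
  by near: n; exact: (cvgr_lt _ (@rampL (ratr a) (ratr c)) _ Lp').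
near=> n.
have Qb : Q n p <= b by near: n; exact: Ab.
have aQ : ratr a < Q n p by near: n; exact: evA.
by rewrite ler_norml; lra.
Unshelve. all: by end_near. Qed.


Let U : probability (measurableTypeR R) R := @unit_interval_prob R.

Let D : set (measurableTypeR R) := `]0, 1[%classic `\` bad.

Let mbad : measurable (bad : set (measurableTypeR R)).
Proof. exact: countable_measurable. Qed.

Let mD : measurable D.
Proof. by apply: measurableD; [exact: measurable_itv|exact: mbad]. Qed.

(** Countable sets are null for Lebesgue measure, so deleting [bad] changes no probability. *)
Let U_D (A : set (measurableTypeR R)) : measurable A ->
  U A = lebesgue_measure (A `&` D).
Proof.
move=> mA; rewrite /U/= unit_interval_probE.
rewrite -(setDUK (_ : A `&` D `<=` A `&` `]0, 1[%classic)); last first.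
  by move=> x [Ax []].
rewrite measureU/=; last 3 first.
- exact: measurableI.
- by apply: measurableD; apply: measurableI => //; exact: measurable_itv.
- by rewrite setDIK.
rewrite [X in (_ + X)%E](_ : _ = 0%E) ?adde0//.
apply/eqP; rewrite eq_le measure_ge0 andbT.
rewrite -(countable_lebesgue_measure0 countable_bad) le_measure ?inE//.
  by apply: measurableD; apply: measurableI => //; exact: measurable_itv.
move=> x [[Ax x01] H]; apply: contrapT => nb; apply: H; split => //; split => //.
Qed.

(** Setting the quantile to 0 off [D] gives measurability on the whole line and convergence at every
    point, so dominated convergence can be used pointwise. *)
Let QD n (p : measurableTypeR R) : R := (Q n \_ D) p.

Let mQD n : measurable_fun setT (QD n).
Proof.
apply/(measurable_restrictT _ mD).
apply: (@measurable_funS _ _ _ _ (`]0, 1[ : set R)) => //.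
  by move=> x [].
exact: (measurable_quantile (@G_nd n) (@G_rc n) (@G_neg n) (@G_lim1 n)).
Qed.

Let Qlim (p : measurableTypeR R) : R := ((fun p => limn (Q ^~ p)) \_ D) p.

Let QD_cvg p : QD n p @[n --> \oo] --> Qlim p.
Proof.
rewrite /QD /Qlim !patchE; case: ifPn => [|pD].
  rewrite inE => -[/= p01 pbad].
  under eq_fun do rewrite patchE ifT ?inE//.
  by apply: cvg_quantile => //; move: p01; rewrite in_itv.
by under eq_fun do rewrite patchE ifN//; exact: cvg_cst.
Qed.

Let mQlim : measurable_fun setT Qlim.
Proof. by apply: (@measurable_fun_cvg _ _ _ _ QD) => // p _; exact: QD_cvg. Qed.

Let QD_ge0 n p : 0 <= QD n p.
Proof.
rewrite /QD patchE; case: ifPn => // /[!inE] -[/= p01 _].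
apply: (quantile_ge0 (@G_neg n) (@G_lim1 n)).
by move: p01; rewrite in_itv.
Qed.

Let G01 n x : 0 <= G n x <= 1.
Proof.
apply/andP; split.
  by apply: Rintegral_ge0 => w _; rewrite indicE.
have := G_tail n x; have : 0 <= \int[P]_w (\1_`]x, +oo[ (Z n w) : R).
  by apply: Rintegral_ge0 => w _; rewrite indicE.
lra.
Qed.

Let mZ n : measurable_fun setT (Z n : T -> R) := measurable_funPT (Z n).

(** Within [D], the quantile exceeds x exactly at the levels above G n x, an interval of length 1 -
    G n x. *)
Let law_QD n (A : set (measurableTypeR R)) : measurable A ->
  law U (mQD n) A = law P (mZ n) A.
Proof.
move: A; apply: probability_eq_rays => x.
have mx : measurable (`]x, +oo[%classic : set R) by exact: measurable_itv.
have mZx : measurable (Z n @^-1` `]x, +oo[) by rewrite -[X in measurable X]setTI;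
  exact: (measurable_funPT (Z n)).
rewrite !lawE.
transitivity ((1 - G n x)%:E); last first.
  rewrite G_tail (_ : \int[P]_w _ = fine (P (Z n @^-1` `]x, +oo[))) ?fineK ?fin_num_measure//.
  by rewrite -Pint_indic.
have /andP[G0 G1] := G01 n x.
have mA : measurable (QD n @^-1` `]x, +oo[).
  by rewrite -[X in measurable X]setTI; exact: mQD.
rewrite (U_D mA).
have [x0|x0] := ltP x 0.
  rewrite G_neg// subr0 (_ : _ `&` D = D); last first.
    rewrite setIidr// => p _ /=; rewrite in_itv/= andbT.
    exact: lt_le_trans x0 (QD_ge0 n p).
  have := U_D measurableT; rewrite setTI => <-; exact: probability_setT.
rewrite (_ : _ `&` D = `]G n x, +oo[%classic `&` D); last first.
  apply/seteqP; split => p [/= h Dp]; split => //; move: h; have [p01 _] := Dp;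
    rewrite !in_itv/= !andbT /QD patchE ifT ?inE//;
    move: p01; rewrite /= in_itv/= => p01; by rewrite ![_ < _]ltNge Q_le.
rewrite -U_D ?unit_interval_probE/=; last exact: measurable_itv.
rewrite unit_interval_probE (_ : _ `&` _ = `]G n x, 1[%classic).
  rewrite lebesgue_measure_itv/= lte_fin; have [_|G1'] := ltP (G n x) 1.
    by rewrite EFinB.
  by rewrite (_ : G n x = 1) ?subrr//; lra.
apply/seteqP; split => p /=; rewrite !in_itv/= !andbT.
  by move=> [-> /andP[]].
by move=> /andP[Gp ->]; rewrite Gp (le_lt_trans G0 Gp).
Qed.

Lemma limit_law_exists : exists nu : probability (measurableTypeR R) R,
  nu `[0, +oo[%classic = 1%E /\
  forall f : R -> R, continuous f -> bounded_fun f ->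
    \int[P]_w f (Z n w) @[n --> \oo] --> \int[nu]_x f x.
Proof.
exists (law U mQlim); split.
  rewrite lawE (_ : _ @^-1` _ = setT) ?probability_setT//.
  apply/seteqP; split => // p _ /=; rewrite in_itv/= andbT.
  rewrite -(cvg_lim (@Rhausdorff R) (@QD_cvg p)); apply: limr_ge.
    by apply/cvg_ex; eexists; exact: QD_cvg.
  by apply: nearW => n; exact: QD_ge0.
move=> f cf [C0 [_ fC0]].
have fC x : `|f x| <= `|C0| + 1.
  by apply: fC0 => //; rewrite ltr_pwDr// ler_norm.
have mf : measurable_fun setT f by exact: continuous_measurable_fun.
have bf : bounded_mfun f by exact: bounded_mfunP mf fC.
rewrite Pint_law//.
have -> : (fun n => \int[P]_w f (Z n w)) = (fun n => \int[U]_p f (QD n p)).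
  apply/funext => n; rewrite -(Pint_law P (mZ n) bf) -(Pint_law U (mQD n) bf).
  congr fine; apply: eq_measure_integral => A mA _.
  by apply/esym; exact: law_QD.
apply: (@Pint_dominated_cvg _ _ _ _ _ _ (`|C0| + 1)).
- by move=> n; apply: measurableT_comp => //; exact: mQD.
- by apply: measurableT_comp => //; exact: mQlim.
- by move=> n p; exact: fC.
- by move=> p; apply: continuous_cvg; [exact: cf|exact: QD_cvg].
Qed.

End limit_law.

(** * Convergence in law from Laplace transforms *)

Section exponential_law.
Context (R : realType).
Notation mu := (@lebesgue_measure R).

Lemma measurable_norm : measurable_fun [set: R] (fun x : R => `|x|).
Proof. by apply: continuous_measurable_fun; exact: norm_continuous. Qed.

Lemma exponential_law1_dom : exponential_law1 R `<< mu.
Proof.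
apply/null_content_dominatesP => A mA muA0; rewrite exponential_law1E /exponential_prob.
apply: null_set_integral => //; apply/measurable_EFinP/measurable_funTS.
exact: measurable_exponential_pdf.
Qed.

(** The law is given by integrals of the density over sets; its Radon-Nikodym derivative has the
    same integrals, so it equals the density almost everywhere. *)
Lemma integral_exponential_law1 (f : R -> R) : bounded_mfun f ->
  (\int[exponential_law1 R]_x (f x)%:E =
   \int[mu]_x ((f x)%:E * (exponential_pdf 1 x)%:E))%E.
Proof.
move=> bf.
have mpdf : measurable_fun setT (EFin \o exponential_pdf (1 : R)).
  by apply/measurable_EFinP; exact: measurable_exponential_pdf.
rewrite -(Radon_Nikodym_change_of_variables exponential_law1_dom)//=; last first.
  exact: (bounded_mfun_integrable (exponential_law1 R) bf).
have mf : measurable_fun setT (EFin \o f) by apply/measurable_EFinP; exact: bf.1.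
apply: ae_eq_integral => //.
- apply: emeasurable_funM => //; apply: (measurable_int mu).
  by apply: Radon_Nikodym_integrable; exact: exponential_law1_dom.
- exact: emeasurable_funM.
- apply: ae_eqe_mul2l => /=.
  rewrite Radon_NikodymE//=; first exact: exponential_law1_dom.
  move=> dom; case: cid => /= h [h1 h2 h3].
  apply: integral_ae_eq => //=.
  by move=> E E01 mE; rewrite -h3.
Qed.

(** The density vanishes on negative numbers. Replacing x by its absolute value yields a variable
    that is nonnegative at every point, as [laplace_compare] demands. *)
Lemma Pint_exponential_law1_norm (f : R -> R) : bounded_mfun f ->
  \int[exponential_law1 R]_x f `|x| = \int[exponential_law1 R]_x f x.
Proof.
move=> bf; rewrite /Rintegral !integral_exponential_law1//; last first.
  by apply: (bounded_mfun_comp bf); exact: measurable_norm.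
congr fine; apply: eq_integral => x _; have [x0|x0] := ltP x 0.
  by rewrite lt0_exponential_pdf// !mule0.
by rewrite ger0_norm.
Qed.

(** On the half-line, exp(- l x) times the density of rate 1 is the density of rate 1 + l divided by
    1 + l. *)
Lemma exponential_law1_laplace (l : R) : 0 <= l ->
  \int[exponential_law1 R]_x expR (- (l * `|x|)) = (1 + l)^-1.
Proof.
move=> l0; have l1 : 0 < 1 + l by rewrite ltr_pwDl.
have bE : bounded_mfun (fun x : R => expR (- (l * `|x|))).
  exact: (bounded_mfun_expRN (Z := fun x : R => `|x|)).
rewrite /Rintegral integral_exponential_law1//.
have E := integralZl measurableT (integrable_exponential_pdf l1) (1 + l)^-1.
rewrite integral_exponential_pdf// mule1 in E.
rewrite -[RHS]/(fine (1 + l)^-1%:E) -E; congr fine; apply: eq_integral => x _.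
have [x0|x0] := ltP x 0; first by rewrite /comp !lt0_exponential_pdf// !mule0.
rewrite /comp !exponential_pdfE// -!EFinM; congr EFin.
by rewrite ger0_norm// mulKf ?gt_eqF// mul1r -expRD; congr expR; ring.
Qed.

End exponential_law.

Lemma near_forall_lt (T : Type) (F : set_system T) (FF : Filter F)
    (Q : nat -> T -> Prop) (N : nat) :
  (forall k, \forall t \near F, Q k t) ->
  \forall t \near F, forall k, (k < N)%N -> Q k t.
Proof.
move=> FQ; elim: N => [|N IH]; first by apply: nearW.
near=> t => k; rewrite ltnS leq_eqVlt => /predU1P[->|].
  by near: t; exact: FQ.
by move: k; near: t.
Unshelve. all: by end_near. Qed.

Lemma bounded_fun_norm_le (R : realType) (f : R -> R) : bounded_fun f ->
  exists C, forall x, `|f x| <= C.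
Proof.
move=> [C [_ fC]]; exists (`|C| + 1) => x; apply: fC => //.
by rewrite ltr_pwDr// ler_norm.
Qed.

(** * Continuity theorems for a family indexed by a real parameter *)

Section laplace_limit.
Context (R : realType) d (T : measurableType d) (P : probability T R).
Context (Z : R -> {RV P >-> R}) (K : R).
Hypothesis Z_ge0 : \forall t \near +oo, forall w, 0 <= Z t w.
Hypothesis Z_tight : \forall t \near +oo, laplace_tight P K (Z t).

Let mZ t : measurable_fun setT (Z t : T -> R) := measurable_funPT (Z t).

Lemma laplace_limit_exponential :
  (forall k : nat, \int[P]_w expR (- (k%:R * Z t w)) @[t --> +oo] --> (1 + k%:R : R)^-1) ->
  cvg_in_law Z (exponential_law1 R).
Proof.
move=> Zk f cf bf; have [C fC] := bounded_fun_norm_le bf.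
have mf : bounded_mfun f by exact: bounded_mfunP (continuous_measurable_fun cf) fC.
have -> : (fun t => \int[distribution P (Z t)]_x (f x)%:E)%E =
    (fun t => (\int[P]_w f (Z t w))%:E).
  apply/funext => t; rewrite EFin_Rintegral; last exact: (bounded_mfun_comp mf).
  rewrite integral_distribution//; first by apply/measurable_EFinP; exact: mf.1.
  by apply: bounded_mfun_integrable; exact: (bounded_mfun_comp mf).
rewrite -EFin_Rintegral//; apply: cvg_EFin; first exact: nearW.
rewrite -Pint_exponential_law1_norm//.
apply/cvgrPdistC_le => e e0.
(* Both variables must share one tightness constant; the exponential law has constant 1, since 1 - 1
   / (1 + l) <= l. *)
have [N [r [r0 cmp]]] := laplace_compare (Num.max K 1) cf fC e0.
have tight1 L d' (T' : measurableType d') (P' : probability T' R) (Y : T' -> R) :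
    L <= Num.max K 1 -> laplace_tight P' L Y -> laplace_tight P' (Num.max K 1) Y.
  by move=> LK tY l l0; rewrite (le_trans (tY _ l0))// ler_wpM2r// ltW.
have near_k : \forall t \near +oo, forall k, (k < N)%N ->
    `|\int[P]_w expR (- (k%:R * Z t w)) - (1 + k%:R)^-1| <= r.
  by apply: near_forall_lt => k; have /cvgrPdistC_le/(_ _ r0) := Zk k.
near=> t.
apply: (cmp _ _ P (Z t) _ _ (exponential_law1 R) (fun x => `|x|)) => //.
- by near: t.
- by apply: (@tight1 K); [rewrite le_max lexx|near: t].
- exact: measurable_norm.
- apply: (@tight1 1); first by rewrite le_max lexx orbT.
  move=> l l0; rewrite exponential_law1_laplace ?(ltW l0)// mul1r.
  have l1 : 0 < 1 + l by rewrite ltr_pwDl// ltW.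
  rewrite (_ : 1 - _ = l / (1 + l)); last by field; rewrite gt_eqF.
  by rewrite ler_pdivrMr// mulrDr mulr1 lerDl mulr_ge0// ltW.
- by move=> k kN; rewrite exponential_law1_laplace//; move: k kN; near: t.
Unshelve. all: by end_near. Qed.

Hypothesis Z_laplace : forall k : nat,
  cvg (\int[P]_w expR (- (k%:R * Z t w)) @[t --> +oo]).

(** With no limit variable at hand yet, [Z s] is compared with [Z t]: their transforms at finitely
    many integers are both close to the same limits. *)
Let Z_cauchy (f : R -> R) (e : R) : continuous f -> bounded_fun f -> 0 < e ->
  exists M, forall s t, M <= s -> M <= t ->
    `|\int[P]_w f (Z s w) - \int[P]_w f (Z t w)| <= e.
Proof.
move=> cf bf e0; have [C fC] := bounded_fun_norm_le bf.
have [N [r [r0 cmp]]] := laplace_compare K cf fC e0.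
pose l (k : nat) := lim (\int[P]_w expR (- (k%:R * Z t w)) @[t --> +oo]).
have r20 : 0 < r / 2 by rewrite divr_gt0.
have near_k : \forall t \near +oo, forall k, (k < N)%N ->
    `|\int[P]_w expR (- (k%:R * Z t w)) - l k| <= r / 2.
  by apply: near_forall_lt => k; have /cvgrPdistC_le/(_ _ r20) := @Z_laplace k.
have [M [_ HM]] := filterI Z_ge0 (filterI Z_tight near_k).
exists (`|M| + 1) => s t Ms Mt.
have MM x : `|M| + 1 <= x -> M < x.
  by apply: lt_le_trans; rewrite ltr_pwDr// ler_norm.
have [s0 [ts ks]] := HM _ (MM _ Ms); have [t0 [tt kt]] := HM _ (MM _ Mt).
apply: (cmp _ _ P (Z s) _ _ P (Z t)) => // k kN.
have := ks _ kN; have := kt _ kN.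
set a := \int[P]_w _; set b := \int[P]_w _ => bl al.
rewrite (_ : b - a = (b - l k) - (a - l k)); last by ring.
by apply: (le_trans (ler_normB _ _)); rewrite [leRHS]splitr; exact: lerD.
Qed.

Lemma laplace_limit_exists :
  exists nu : probability (measurableTypeR R) R, nu `[0, +oo[%classic = 1%E /\
  (cvg_in_law Z nu /\
   forall f : R -> R, continuous f -> bounded_fun f ->
    \int[P]_w f (Z t w) @[t --> +oo] --> \int[nu]_x f x).
Proof.
have [M [_ HM]] := filterI Z_ge0 Z_tight.
(* Starting beyond [M] makes positivity and tightness hold along the whole sequence. The Cauchy
   bound later extends the convergence to real t. *)
pose s (n : nat) := `|M| + 1 + n%:R.
have Ms n : M < s n.
  by rewrite /s -addrA (le_lt_trans (ler_norm _))// ltrDl ltr_pwDl.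
have sE e : \forall n \near \oo, e <= s n.
  near=> n; rewrite /s ler_wpDl ?addr_ge0//; near: n; exact: nbhs_infty_ger.
have [|n M0 M00|f cf bf|nu [nu1 nuf]] := @limit_law_exists R _ T P (fun n => Z (s n)) (2 * K).
- by move=> n; have [] := HM _ (Ms n).
- by have [? ?] := HM _ (Ms n); apply: laplace_tail.
- apply: cauchy_cvg; apply: cauchy_exP => e e0.
  have e20 : 0 < e / 2 by rewrite divr_gt0.
  have [M1 HM1] := Z_cauchy cf bf e20.
  exists (\int[P]_w f (Z M1 w)).
  suff H : \forall n \near \oo, ball (\int[P]_w f (Z M1 w)) e (\int[P]_w f (Z (s n) w)) by exact: H.
  near=> n; rewrite -ball_normE/=.
  apply: (@le_lt_trans _ _ (e / 2)); last by rewrite ltr_pdivrMr// ltr_pMr// ltr1n.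
  by apply: HM1 => //; near: n; exact: sE.
have cvgR f : continuous f -> bounded_fun f ->
    \int[P]_w f (Z t w) @[t --> +oo] --> \int[nu]_x f x.
  move=> cf bf; apply/cvgrPdistC_le => e e0.
  have e20 : 0 < e / 2 by rewrite divr_gt0.
  have [M1 HM1] := Z_cauchy cf bf e20.
  have /cvgrPdistC_le/(_ _ e20) near_n := nuf f cf bf.
  have [n [n1 n2]] := @filter_ex _ \oo _ _ (filterI near_n (sE M1)).
  near=> t.
  have tM : M1 <= t by near: t; apply: nbhs_pinfty_ge; exact: num_real.
  have := HM1 _ _ tM n2; move: n1 => /=.
  set a := \int[P]_w _; set b := \int[P]_w _; set c := \int[nu]_x _ => h1 h2.
  rewrite (_ : b - c = (b - a) + (a - c)); last by ring.
  by rewrite (le_trans (ler_normD _ _))// [leRHS]splitr lerD.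
exists nu; split => //; split => // f cf bf.
have [C fC] := bounded_fun_norm_le bf.
have mf : bounded_mfun f by exact: bounded_mfunP (continuous_measurable_fun cf) fC.
have -> : (fun t => \int[distribution P (Z t)]_x (f x)%:E)%E =
    (fun t => (\int[P]_w f (Z t w))%:E).
  apply/funext => t; rewrite EFin_Rintegral; last exact: (bounded_mfun_comp mf).
  rewrite integral_distribution//; first by apply/measurable_EFinP; exact: mf.1.
  by apply: bounded_mfun_integrable; exact: (bounded_mfun_comp mf).
rewrite -EFin_Rintegral//; apply: cvg_EFin; first exact: nearW.
exact: cvgR.
Unshelve. all: by end_near. Qed.

End laplace_limit.

(** * Truncated expectations of analytic functions *)

(** The factor [k] is kept apart on purpose: with k = y it makes the remainder of a power series
    linear in y. *)
Lemma series_dominated (R : realType) (A b : nat -> R) (k l : R) : 0 <= k ->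
  (forall n, `|b n| <= k * A n) ->
  series A @ \oo --> l ->
  cvgn (series b) /\ forall N, `|limn (series b) - series b N| <= k * (l - series A N).
Proof.
move=> k0 bA cA.
have A0 n : 0 <= k * A n by exact: le_trans (normr_ge0 _) (bA n).
have ckA : series (fun n => k * A n) @ \oo --> k * l.
  rewrite (_ : series _ = fun n => k * series A n); first exact: cvgMr.
  by apply/funext => n; rewrite /series/= mulr_sumr.
have cb : cvgn (series b).
  apply: normed_cvg; apply: (series_le_cvg _ _ bA) => //.
  by apply/cvg_ex; eexists; exact: ckA.
split => // N.
have cv : `|series b M - series b N| @[M --> \oo] --> `|limn (series b) - series b N|.
  by apply: cvg_norm; apply: cvgB; [exact: cb|exact: cvg_cst].
have cA' : k * (series A M - series A N) @[M --> \oo] --> k * (l - series A N).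
  by apply: cvgMl_tmp; apply: cvgB; [exact: cA|exact: cvg_cst].
rewrite -(cvg_lim (@Rhausdorff R) cv) -(cvg_lim (@Rhausdorff R) cA').
apply: ler_lim; [by apply/cvg_ex; eexists; exact: cv|by apply/cvg_ex; eexists; exact: cA'|].
near=> M.
have NM : (N <= M)%N by near: M; exact: nbhs_infty_ge.
rewrite -(subnKC NM); elim: (M - N)%N => [|i IH]; first by rewrite addn0 !subrr normr0 mulr0.
rewrite addnS !seriesSr.
rewrite (_ : _ - series b N = (series b (N + i) - series b N) + b (N + i)%N); last by ring.
rewrite (_ : k * _ = k * (series A (N + i) - series A N) + k * A (N + i)%N); last by ring.
by rewrite (le_trans (ler_normD _ _))// lerD.
Unshelve. all: by end_near. Qed.

Section series_ratio.
Context (R : realType) d (T : measurableType d) (P : probability T R) (X : T -> R).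
Hypothesis mX : measurable_fun setT X.
Hypothesis X0 : forall w, 0 <= X w.
Hypothesis tail_gt0 : forall t, 0 < tail P X t.

Definition truncated_moment n t := \int[P]_w (X w ^+ n * \1_`[0, t[ (X w)) : R.

Lemma bounded_mfun_trunc (h : R -> R) (C t : R) : measurable_fun setT h ->
  (forall x, 0 <= x < t -> `|h x| <= C) ->
  bounded_mfun (fun w => h (X w) * \1_`[0, t[ (X w)).
Proof.
move=> mh hC; apply: (@bounded_mfun_comp _ _ _ _ _ (fun x => h x * \1_`[0, t[ x)) => //.
apply: (@bounded_mfunP _ _ _ _ `|C|).
  by apply: measurable_funM => //; exact: measurable_indic.
move=> x; rewrite indicE; have [|_] := boolP (x \in _); last by rewrite mulr0 normr0.
by rewrite inE/= in_itv/= mulr1 => /hC /le_trans; apply; exact: ler_norm.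
Qed.

Lemma bounded_mfun_trunc_expr n t :
  bounded_mfun (fun w => X w ^+ n * \1_`[0, t[ (X w)).
Proof.
apply: (@bounded_mfun_trunc (fun x => x ^+ n) (t ^+ n)); first exact: measurable_funX.
move=> x /andP[x0 xt]; rewrite ger0_norm ?exprn_ge0//.
by rewrite lerXn2r// ?nnegrE ?ltW// (le_lt_trans x0).
Qed.

Context (kappa : nat -> R).
Hypothesis moment_ratio : forall n, (0 < n)%N ->
  truncated_moment n t / (t ^+ n * tail P X t) @[t --> +oo] --> kappa n.

(** On the truncation event X / t lies in [0, 1[, so its powers stay below the first one. Bounded
    [kappa] keeps the limit series dominated by [A]. *)
Lemma kappa_le n : (0 < n)%N -> 0 <= kappa n <= kappa 1.
Proof.
move=> n0; apply/andP; split.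
  rewrite -(cvg_lim (@Rhausdorff R) (moment_ratio n0)); apply: limr_ge.
    by apply/cvg_ex; eexists; exact: moment_ratio.
  near=> t; have t0 : 0 < t by near: t; apply: nbhs_pinfty_gt; exact: num_real.
  rewrite divr_ge0 ?mulr_ge0 ?exprn_ge0 ?(ltW t0) ?(ltW (tail_gt0 _))//.
  by apply: Rintegral_ge0 => w _; rewrite mulr_ge0 ?exprn_ge0// indicE.
rewrite -(cvg_lim (@Rhausdorff R) (moment_ratio n0)).
rewrite -(cvg_lim (@Rhausdorff R) (moment_ratio (ltn0Sn 0))).
apply: ler_lim; [by apply/cvg_ex; eexists; exact: moment_ratio..|].
near=> t; have t0 : 0 < t by near: t; apply: nbhs_pinfty_gt; exact: num_real.
have Ft := tail_gt0 t; have tn : 0 < t ^+ n by rewrite exprn_gt0.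
rewrite ler_pdivrMr ?mulr_gt0// mulrAC ler_pdivlMr ?mulr_gt0//.
rewrite !mulrA ler_pM2r// /truncated_moment -!PintZr//; last 2 first.
- exact: bounded_mfun_trunc_expr.
- exact: bounded_mfun_trunc_expr.
apply: le_Pint.
- apply: bounded_mfunM; [exact: bounded_mfun_trunc_expr|exact: bounded_mfun_cst].
- apply: bounded_mfunM; [exact: bounded_mfun_trunc_expr|exact: bounded_mfun_cst].
move=> w; rewrite indicE; have [|_] := boolP (X w \in _); last by rewrite !mulr0 !mul0r.
rewrite inE/= in_itv/= !mulr1 !expr1 => /andP[_ Xt].
rewrite -(prednK n0) !exprS -mulrA; apply: ler_wpM2l => //.
rewrite mulrC; apply: ler_wpM2l; first exact: ltW.
by rewrite lerXn2r// ?nnegrE ?(ltW t0)// ltW.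
Unshelve. all: by end_near. Qed.

(** Because a 0 = 0 and y^n <= y for n > 0, cutting the series at N costs at most y * eps N. After
    integration this is eps N times the first moment ratio, which stays bounded for large t, so sum
    and limit may be exchanged. A constant term would contribute P(X < t) / F(t), which diverges. *)
Lemma series_ratio (g : R -> R) (a A : nat -> R) :
  measurable_fun setT g -> a 0%N = 0 -> (forall n, `|a n| <= A n) ->
  cvgn (series A) ->
  (forall y, 0 <= y <= 1 -> series (fun n => a n * y ^+ n) @ \oo --> g y) ->
  cvgn (series (fun n => a n * kappa n)) /\
  (\int[P]_w (g (X w / t) * \1_`[0, t[ (X w))) / tail P X t @[t --> +oo] -->
    limn (series (fun n => a n * kappa n)).
Proof.
move=> mg a0 aA cA ga.
have k0 : 0 <= kappa 1 by have /andP[] := kappa_le (ltn0Sn 0).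
pose eps N := limn (series A) - series A N.
have A0 n : 0 <= A n by exact: le_trans (normr_ge0 _) (aA n).
have [|cS limS] := @series_dominated R A
  (fun n => a n * kappa n) (kappa 1) (limn (series A)) k0 _ cA.
  case=> [|n]; first by rewrite a0 mul0r normr0 mulr_ge0.
  have /andP[kn0 kn1] := kappa_le (ltn0Sn n).
  by rewrite normrM mulrC ler_pM// ger0_norm.
split => //; set S := limn _ in limS *.
have geps y N : 0 <= y <= 1 -> `|g y - series (fun n => a n * y ^+ n) N| <= y * eps N.
  move=> y01; have /andP[y0 y1] := y01.
  have [|_] := @series_dominated R A (fun n => a n * y ^+ n) y (limn (series A)) y0 _ cA.
    case=> [|n]; first by rewrite a0 mul0r normr0 mulr_ge0.
    rewrite normrM mulrC ler_pM// ger0_norm ?exprn_ge0// exprS.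
    by rewrite ler_piMr// exprn_ile1.
  by rewrite (cvg_lim (@Rhausdorff R) (ga _ y01)); apply.
have eps0 : eps N @[N --> \oo] --> 0.
  rewrite -(subrr (limn (series A))); apply: cvgB; [exact: cvg_cst|exact: cA].
have partial N : \sum_(0 <= n < N) a n * (truncated_moment n t / (t ^+ n * tail P X t))
    @[t --> +oo] --> series (fun n => a n * kappa n) N.
  elim: N => [|N IH].
    under eq_fun do rewrite big_nil.
    by rewrite /series/= big_nil; exact: cvg_cst.
  under eq_fun do rewrite big_nat_recr//=.
  rewrite seriesSr; apply: cvgD => //.
  case: N {IH} => [|N]; last by apply: cvgMl_tmp; exact: moment_ratio.
  by rewrite a0 mul0r; under eq_fun do rewrite mul0r; exact: cvg_cst.
have approx N t : 0 < t ->
    `|(\int[P]_w (g (X w / t) * \1_`[0, t[ (X w))) / tail P X t -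
      \sum_(0 <= n < N) a n * (truncated_moment n t / (t ^+ n * tail P X t))|
    <= eps N * (truncated_moment 1 t / (t ^+ 1 * tail P X t)).
  move=> t0; have Ft := tail_gt0 t.
  have xt x : 0 <= x < t -> 0 <= x / t <= 1.
    by move=> /andP[x0 xt]; rewrite divr_ge0 ?(ltW t0)//= ler_pdivrMr// mul1r ltW.
  have mgt : measurable_fun setT (fun x : R => g (x / t)).
    by apply: measurableT_comp => //; exact: measurable_funM.
  have bg : bounded_mfun (fun w => g (X w / t) * \1_`[0, t[ (X w)).
    apply: (@bounded_mfun_trunc (fun x : R => g (x / t)) `|eps 0%N|) => // x /xt xt01.
    have := geps _ 0%N xt01; rewrite /series/= big_nil subr0 => /le_trans; apply.
    have /andP[y0 y1] := xt01.
    by rewrite (@le_trans _ _ (x / t * `|eps 0%N|))// ?ler_wpM2l ?ler_norm// ler_piMl.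
  have bm n : bounded_mfun (fun w => a n * (t ^- n) * (X w ^+ n * \1_`[0, t[ (X w))).
    by apply: bounded_mfunM; [exact: bounded_mfun_cst|exact: bounded_mfun_trunc_expr].
  have -> : \sum_(0 <= n < N) a n * (truncated_moment n t / (t ^+ n * tail P X t)) =
      (\int[P]_w \sum_(0 <= n < N) (a n * (t ^- n) * (X w ^+ n * \1_`[0, t[ (X w)))) / tail P X t.
    rewrite Pint_sum// mulr_suml; apply: eq_bigr => n _.
    rewrite PintZl; last exact: bounded_mfun_trunc_expr.
    by rewrite -/(truncated_moment n t) invfM; ring.
  rewrite -mulrBl -PintB//; last exact: bounded_mfun_sum.
  rewrite expr1 (_ : eps N * _ = (\int[P]_w (eps N / t * (X w ^+ 1 *
    \1_`[0, t[ (X w)))) / tail P X t); last first.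
    rewrite PintZl; last exact: bounded_mfun_trunc_expr.
    by rewrite -/(truncated_moment 1 t) invfM; ring.
  rewrite normrM normfV (gtr0_norm Ft) ler_pM2r ?invr_gt0//.
  apply: ler_norm_Pint.
  - by apply: bounded_mfunB => //; exact: bounded_mfun_sum.
  - by apply: bounded_mfunM; [exact: bounded_mfun_cst|exact: bounded_mfun_trunc_expr].
  move=> w; rewrite indicE; have [|_] := boolP (X w \in _); last first.
    rewrite mulr0 big1 => [|n _]; last by rewrite !mulr0.
    by rewrite subrr normr0 !mulr0.
  rewrite inE/= in_itv/= !mulr1 expr1 => /xt/(geps _ N).
  rewrite (_ : series _ N = \sum_(0 <= n < N) a n * t ^- n * (X w ^+ n * 1)); last first.
    by apply: eq_bigr => n _; rewrite exprMn exprVn; ring.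
  by move=> /le_trans; apply; rewrite le_eqVlt; apply/orP; left; apply/eqP; ring.
apply/cvgrPdist_le => e e0.
(* One [kappa 1] bounds the remainder of the limit series; [kappa 1 + 1] bounds the first moment
   ratio for large t. *)
have [N epsN] : exists N, (kappa 1 + (kappa 1 + 1)) * `|eps N| <= e / 2.
  have : (kappa 1 + (kappa 1 + 1)) * `|eps N| @[N --> \oo] --> (kappa 1 + (kappa 1 + 1)) * `|0 : R|.
    by apply: cvgMl_tmp; exact: cvg_norm.
  rewrite normr0 mulr0 => c0; have e20 : 0 < e / 2 by rewrite divr_gt0.
  have [N] := @filter_ex _ \oo _ _ (cvgr_lt _ c0 _ e20).
  by move=> /ltW; exists N.
have e20 : 0 < e / 2 by rewrite divr_gt0.
have /cvgrPdist_le/(_ _ e20) hp := partial N.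
have k11 : kappa 1 < kappa 1 + 1 by rewrite ltrDl.
have hm := cvgr_lt _ (moment_ratio (ltn0Sn 0)) _ k11.
near=> t.
have t0 : 0 < t by near: t; apply: nbhs_pinfty_gt; exact: num_real.
have h1 := approx N t t0.
have h2 := limS N.
have h3 : `|series (fun n => a n * kappa n) N -
  \sum_(0 <= n < N) a n * (truncated_moment n t / (t ^+ n * tail P X t))| <= e / 2 by near: t.
have h4 : truncated_moment 1 t / (t ^+ 1 * tail P X t) <= kappa 1 + 1.
  by apply: ltW; near: t; exact: hm.
have h50 : 0 <= truncated_moment 1 t / (t ^+ 1 * tail P X t).
  rewrite divr_ge0 ?mulr_ge0 ?exprn_ge0 ?(ltW t0) ?(ltW (tail_gt0 _))//.
  by apply: Rintegral_ge0 => w _; rewrite mulr_ge0 ?exprn_ge0// indicE.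
have h5 : eps N * (truncated_moment 1 t / (t ^+ 1 * tail P X t)) <= (kappa 1 + 1) * `|eps N|.
  apply: (@le_trans _ _ (`|eps N| * (truncated_moment 1 t / (t ^+ 1 * tail P X t)))).
    by rewrite ler_wpM2r// ler_norm.
  by rewrite mulrC ler_wpM2r.
have h6 : kappa 1 * eps N <= kappa 1 * `|eps N| by rewrite ler_wpM2l// ler_norm.
move: h1 h2 h3; set u := \int[P]_w _ / _; set v := \sum_(_ <= _ < _) _; set z := series _ N.
move=> h1 h2 h3.
rewrite (_ : S - u = (S - z) + (z - v) - (u - v)); last by ring.
apply: (le_trans (ler_normB _ _)); apply: (le_trans (lerD (ler_normD _ _) (lexx _))).
apply: (le_trans (lerD (lerD (le_trans h2 h6) h3) (le_trans h1 h5))).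
by move: epsN; rewrite mulrDl; lra.
Unshelve. all: by end_near. Qed.

End series_ratio.

(** * Exponential limits *)

Section passage_laplace.
Context (R : realType) (d : measure_display) (T : measurableType d)
  (P : probability T R) (X : nat -> {RV P >-> R}).
Hypothesis X_indep : mutually_independent X.
Hypothesis X_ident : identically_distributed X.
Hypothesis X_ge0 : forall i w, 0 <= X i w.

Notation Y := (sum_before_passage X).
Notation F := (tail P (X 0%N)).

(** As 1 = F(t) + P(X < t), division by F(t) turns 1 - E[a; X < t] into 1 plus the ratio for 1 - a,
    whose integrand vanishes at 0. *)
Lemma passage_ratio (a b : R -> R) (t : R) :
  measurable_fun setT a -> measurable_fun setT b ->
  (forall x, 0 <= x -> `|a x| <= 1) -> (forall x, 0 <= x -> `|b x| <= 1) ->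
  a 0 = 1 -> b 0 = 0 ->
  (forall x y, 0 <= x -> 0 <= y -> a (x + y) = a x * a y - b x * b y) ->
  (forall x y, 0 <= x -> 0 <= y -> b (x + y) = a x * b y + b x * a y) ->
  0 < F t ->
  let u := \int[P]_w a (Y t w) in let v := \int[P]_w b (Y t w) in
  let ra := (\int[P]_w ((1 - a (X 0%N w)) * \1_`[0, t[ (X 0%N w))) / F t in
  let rb := (\int[P]_w (b (X 0%N w) * \1_`[0, t[ (X 0%N w))) / F t in
  u * (1 + ra) + v * rb = 1 /\ v * (1 + ra) - u * rb = 0.
Proof.
move=> ma mb a1 b1 a0 b0 aD bD F0 /=.
have mX : measurable_fun setT (X 0%N : T -> R) by [].
have [] := passage_character X_indep X_ident X_ge0 ma mb a1 b1 a0 b0 aD bD F0.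
have baX : bounded_mfun (fun w => a (X 0%N w) * \1_`[0, t[ (X 0%N w)).
  by apply: (bounded_mfun_trunc mX (C := 1) ma) => x /andP[x0 _]; exact: a1.
have b1X : bounded_mfun (fun w => \1_`[0, t[ (X 0%N w) : R).
  exact: (bounded_mfun_indic_comp mX).
have E : \int[P]_w ((1 - a (X 0%N w)) * \1_`[0, t[ (X 0%N w)) =
    1 - F t - \int[P]_w (a (X 0%N w) * \1_`[0, t[ (X 0%N w)).
  under eq_Rintegral do rewrite mulrBl mul1r.
  by rewrite PintB// (Pint_indic_itvC X_ge0).
rewrite E -/(F t).
set u := \int[P]_w a _; set v := \int[P]_w b _.
set al := \int[P]_w (a _ * _); set be := \int[P]_w (b _ * _).
move=> h1 h2; have Fn0 : F t != 0 by rewrite gt_eqF.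
split.
  transitivity ((u * (1 - al) + v * be) / F t); first by field.
  by rewrite h1 divff.
transitivity ((v * (1 - al) - u * be) / F t); first by field.
by rewrite h2 mul0r.
Qed.

Lemma measurable_expRN (l : R) : measurable_fun setT (fun x : R => expR (- (l * x))).
Proof.
apply: continuous_measurable_fun => x; apply: continuous_comp; last exact: continuous_expR.
by apply: continuousN; apply: cvgMl_tmp; exact: cvg_id.
Qed.

Definition laplace_ratio (l A t : R) : R :=
  (\int[P]_w ((1 - expR (- (l * (X 0%N w / A)))) * \1_`[0, t[ (X 0%N w))) / F t.

(** This is the mean of Y_t / A: the number of terms is geometric and each is distributed as X
    conditioned on X < t. *)
Definition mean_ratio (A t : R) : R :=
  (\int[P]_w (X 0%N w * \1_`[0, t[ (X 0%N w))) / (A * F t).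

Lemma passage_laplace (l A t : R) : 0 <= l -> 0 < A -> 0 < F t ->
  (\int[P]_w expR (- (l * (Y t w / A)))) * (1 + laplace_ratio l A t) = 1.
Proof.
move=> l0 A0 F0; pose a x := expR (- (l * (x / A))).
have ma : measurable_fun setT a.
  rewrite (_ : a = fun x => expR (- ((l / A) * x))); first exact: measurable_expRN.
  by apply/funext => x; rewrite /a; congr expR; ring.
have [] := @passage_ratio a (fun=> 0) t ma.
- exact: measurable_cst.
- move=> x x0; rewrite ger0_norm ?expR_ge0// -expR0 ler_expR oppr_le0.
  by rewrite mulr_ge0// divr_ge0// ltW.
- by move=> x _; rewrite normr0.
- by rewrite /a mul0r mulr0 oppr0 expR0.
- by [].
- by move=> x y _ _; rewrite /a mulr0 subr0 -expRD; congr expR; ring.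
- by move=> x y _ _; rewrite mulr0 mul0r addr0.
- exact: F0.
by rewrite Pint_cst mul0r addr0 -/(laplace_ratio l A t).
Qed.

Section bounds.
Context (l A t : R).
Hypothesis l_ge0 : 0 <= l.
Hypothesis A_gt0 : 0 < A.
Hypothesis F_gt0 : 0 < F t.

Let mX : measurable_fun setT (X 0%N : T -> R). Proof. by []. Qed.

Let bX1 : bounded_mfun (fun w => X 0%N w * \1_`[0, t[ (X 0%N w)).
Proof.
apply: (bounded_mfun_trunc mX (h := id) (C := t)); first exact: measurable_id.
by move=> x /andP[x0 xt]; rewrite ger0_norm// ltW.
Qed.

Let bL : bounded_mfun (fun w => (1 - expR (- (l * (X 0%N w / A)))) * \1_`[0, t[ (X 0%N w)).
Proof.
apply: (bounded_mfun_trunc mX (h := fun x => 1 - expR (- (l * (x / A)))) (C := 1)).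
  apply: measurable_funB; first exact: measurable_cst.
  rewrite (_ : (fun x => _) = fun x => expR (- ((l / A) * x))); first exact: measurable_expRN.
  by apply/funext => x; congr expR; ring.
move=> x /andP[x0 _]; have := expR_ge0 (- (l * (x / A))).
have : expR (- (l * (x / A))) <= 1.
  by rewrite -expR0 ler_expR oppr_le0 mulr_ge0// divr_ge0// ltW.
by move=> h1 h2; rewrite ger0_norm; lra.
Qed.

Lemma laplace_ratio_ge0 : 0 <= laplace_ratio l A t.
Proof.
rewrite divr_ge0 ?(ltW F_gt0)//; apply: Rintegral_ge0 => w _.
rewrite mulr_ge0//.
by rewrite subr_ge0 -expR0 ler_expR oppr_le0 mulr_ge0// divr_ge0 ?X_ge0// ltW.
Qed.

Lemma laplace_ratio_le : laplace_ratio l A t <= l * mean_ratio A t.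
Proof.
rewrite /laplace_ratio /mean_ratio (_ : l * _ = ((l / A) * \int[P]_w (X 0%N w *
  \1_`[0, t[ (X 0%N w))) / F t); last first.
  by rewrite invfM; ring.
rewrite ler_pM2r ?invr_gt0// -PintZl//; apply: le_Pint => //.
  by apply: bounded_mfunM => //; exact: bounded_mfun_cst.
move=> w; rewrite [leRHS]mulrA; apply: ler_wpM2r; first by rewrite indicE.
have := expR_ge1Dx (- (l * (X 0%N w / A))).
by rewrite (_ : l / A * X 0%N w = l * (X 0%N w / A)); [lra|ring].
Qed.

(** The bound exp(- y) <= 1 - y + y^2 follows from (1 + y) exp(- y) <= 1, because (1 + y)(1 - y +
    y^2) = 1 + y^3. In y^2 one factor X is replaced by t, so the correction is again a truncated
    mean. *)
Lemma laplace_ratio_ge :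
  l * mean_ratio A t - l ^+ 2 * (t / A) * mean_ratio A t <= laplace_ratio l A t.
Proof.
rewrite /laplace_ratio /mean_ratio.
rewrite (_ : _ - _ = (((l / A) - (l / A) ^+ 2 * t) * \int[P]_w (X 0%N w *
  \1_`[0, t[ (X 0%N w))) / F t); last first.
  by rewrite invfM; ring.
rewrite ler_pM2r ?invr_gt0// -PintZl//; apply: le_Pint => //.
  by apply: bounded_mfunM => //; exact: bounded_mfun_cst.
move=> w; rewrite indicE; have [|_] := boolP (_ \in _); last by rewrite !mulr0.
rewrite inE/= in_itv/= !mulr1 => /andP[x0 xt].
set x := X 0%N w in x0 xt *; pose y := l * (x / A).
have y0 : 0 <= y by rewrite mulr_ge0// divr_ge0// ltW.
have ey : expR (- y) * (1 + y) <= 1.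
  rewrite expRN mulrC ler_pdivrMr ?expR_gt0// mul1r.
  exact: expR_ge1Dx.
have ley : expR (- y) <= 1 - y + y ^+ 2.
  have y1 : 0 < 1 + y by rewrite ltr_pwDl.
  rewrite -(ler_pM2r y1) (le_trans ey)//.
  rewrite (_ : _ * (1 + y) = 1 + y ^+ 3); last by ring.
  by rewrite lerDl exprn_ge0.
rewrite -/y (@le_trans _ _ (y - y ^+ 2))//; last by lra.
rewrite mulrBl (_ : l / A * x = y); last by rewrite /y; ring.
rewrite lerD2l lerN2 (_ : y ^+ 2 = (l / A) ^+ 2 * (x * x)); last by rewrite /y; ring.
by rewrite -[leRHS]mulrA; apply: ler_wpM2l; rewrite ?sqr_ge0// ler_wpM2r// ltW.
Qed.

End bounds.

(** From u (1 + r) = 1 comes 1 - u = u r <= r, and r is at most l times the mean ratio. *)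
Lemma laplace_tight_normalized (K A t : R) : 0 < A -> 0 < t -> 0 < F t ->
  mean_ratio A t <= K -> laplace_tight P K (normalized_sum X t A).
Proof.
move=> A0 t0 F0 MK l l0.
have := passage_laplace (ltW l0) A0 F0.
have := laplace_ratio_ge0 (ltW l0) A0 F0.
have := laplace_ratio_le (ltW l0) A0 F0.
rewrite (_ : \int[P]_w expR (- (l * normalized_sum X t A w)) =
  \int[P]_w expR (- (l * (Y t w / A))))//.
set u := \int[P]_w _; set r := laplace_ratio _ _ _ => rl r0 ur.
have u0 : 0 <= u by apply: Rintegral_ge0 => w _; exact: expR_ge0.
have u1 : u <= 1 by rewrite -ur mulrDr mulr1 lerDl mulr_ge0.
have -> : 1 - u = u * r by rewrite -ur; ring.
rewrite (@le_trans _ _ r)//; first by rewrite ler_piMl.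
by rewrite (le_trans rl)// mulrC ler_wpM2r// ltW.
Qed.

Hypothesis F_gt0 : forall t, 0 < F t.

Lemma normalized_sum_ge0 (A t : R) w : 0 < A -> 0 <= normalized_sum X t A w.
Proof.
by move=> A0; rewrite normalized_sumE divr_ge0 ?(ltW A0)//; exact: (partial_sum_ge0 X_ge0).
Qed.

Lemma exponential_limit (A : R -> R) :
  (\forall t \near +oo, 0 < A t) ->
  t / A t @[t --> +oo] --> (0 : R) ->
  mean_ratio (A t) t @[t --> +oo] --> (1 : R) ->
  cvg_in_law (fun t => normalized_sum X t (A t)) (exponential_law1 R).
Proof.
move=> A0 tA M1.
have t_gt0 : \forall t \near +oo, (0 : R) < t by apply: nbhs_pinfty_gt; exact: num_real.
(* The constant 2 is any number above 1, the limit of the mean ratio. *)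
apply: (@laplace_limit_exponential _ _ _ _ _ 2).
- by near=> t => w; apply: normalized_sum_ge0; near: t.
- near=> t; apply: laplace_tight_normalized => //; [by near: t..|].
  by apply: ltW; near: t; apply: (cvgr_lt _ M1); rewrite ltr1n.
move=> k.
have rk : laplace_ratio k%:R (A t) t @[t --> +oo] --> (k%:R : R).
  apply: (@squeeze_cvgr _ _ _ _
    (fun t => k%:R * mean_ratio (A t) t - k%:R ^+ 2 * (t / A t) * mean_ratio (A t) t)
    (fun t => k%:R * mean_ratio (A t) t)).
  - near=> t; apply/andP; split.
      by apply: laplace_ratio_ge => //; near: t.
    by apply: laplace_ratio_le => //; near: t.
  - rewrite [X in _ --> X](_ : _ = k%:R * 1 - k%:R ^+ 2 * 0 * 1); last by ring.
    by apply: cvgB; [exact: cvgMr|apply: cvgM => //; exact: cvgMr].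
  - by rewrite -[X in _ --> X]mulr1; exact: cvgMr.
have k1 : (1 + k%:R : R) != 0 by rewrite gt_eqF// ltr_pwDl.
have : (1 + laplace_ratio k%:R (A t) t)^-1 @[t --> +oo] --> (1 + k%:R : R)^-1.
  by apply: cvgV => //; apply: cvgD => //; exact: cvg_cst.
apply: cvg_trans; apply: near_eq_cvg; near=> t.
have At : 0 < A t by near: t.
have r0 := laplace_ratio_ge0 (ler0n R k) At (F_gt0 t).
have n0 : 1 + laplace_ratio k%:R (A t) t != 0 by rewrite gt_eqF// ltr_pwDl.
apply: (mulIf n0); rewrite mulVf//.
by have := passage_laplace (ler0n R k) At (F_gt0 t).
Unshelve. all: by end_near. Qed.

Context (c alpha : R).
Hypothesis c_gt0 : 0 < c.
Hypothesis alpha_gt0 : 0 < alpha.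
Hypothesis tail_power : F x / (c * x `^ (- alpha)) @[x --> +oo] --> (1 : R).

Let mX : measurable_fun setT (X 0%N : T -> R). Proof. by []. Qed.
Let X00 w : 0 <= X 0%N w. Proof. by []. Qed.

Lemma critical_limit : alpha = 1 ->
  cvg_in_law (fun t => normalized_sum X t (t * ln t)) (exponential_law1 R).
Proof.
move=> a1; apply: exponential_limit.
- near=> t; have t1 : 1 < t by near: t; apply: nbhs_pinfty_gt; exact: num_real.
  by rewrite mulr_gt0 ?ln_gt0// (lt_trans _ t1).
- have : (ln t)^-1 @[t --> +oo] --> (0 : R).
    apply/gtr0_cvgV0; last exact: cvg_ln_pinfty.
    by near=> u; apply: ln_gt0; near: u; apply: nbhs_pinfty_gt; exact: num_real.
  apply: cvg_trans; apply: near_eq_cvg; near=> t.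
  have t1 : 1 < t by near: t; apply: nbhs_pinfty_gt; exact: num_real.
  have t0 : 0 < t by rewrite (lt_trans _ t1).
  have l0 : 0 < ln t by exact: ln_gt0.
  by field; rewrite !gt_eqF.
- exact: (truncated_mean_log mX X00 c_gt0 alpha_gt0 tail_power a1).
Unshelve. all: by end_near. Qed.

(** Monotone convergence is applied along the integers and monotonicity fills in the real t. The
    bound on the truncated means makes the expectation finite, so [fine] returns its true value. *)
Lemma expectation_tmean : 1 < alpha ->
  tmean P (X 0%N) t @[t --> +oo] --> fine 'E_P[X 0%N].
Proof.
move=> a1; have [C HC] := tmean_bounded_power mX X00 c_gt0 alpha_gt0 tail_power a1.
pose m (n : nat) := tmean P (X 0%N) n%:R.
have nd : nondecreasing_seq m by move=> p q pq; apply: (tmean_nd P mX X00); rewrite ler_nat.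
have cm : cvgn m by apply: nondecreasing_is_cvgn => //; exists C => _ [n _ <-]; exact: HC.
have E : ('E_P[X 0%N])%E = (limn m)%:E.
  have mono : (\int[P]_w (Num.min (X 0%N w) n%:R)%:E)%E @[n --> \oo] --> (\int[P]_w (X 0%N w)%:E)%E.
    have lm w : (Num.min (X 0%N w) n%:R)%:E @[n --> \oo] --> (X 0%N w)%:E.
      apply: cvg_EFin; first exact: nearW.
      by apply: cvg_near_cst; near=> n; apply/min_idPl; near: n; exact: nbhs_infty_ger.
    rewrite (_ : (\int[P]_w (X 0%N w)%:E)%E =
        (\int[P]_w limn (fun n : nat => (Num.min (X 0%N w) n%:R)%:E))%E); last first.
      by apply: eq_integral => w _; apply/esym/cvg_lim => //; exact: lm.
    apply: cvg_monotone_convergence => //.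
    - by move=> n; apply/measurable_EFinP; exact: (bounded_mfun_min mX X00 _).1.
    - by move=> n w _; rewrite lee_fin le_min X00 ler0n.
    - by move=> w _ p q pq; rewrite lee_fin le_min ge_min lexx/= ge_min ler_nat pq orbT.
  rewrite expectation_def; apply/esym; apply: cvg_unique mono => //.
  have -> : (fun n : nat => (\int[P]_w (Num.min (X 0%N w) n%:R)%:E)%E) = EFin \o m.
    by apply/funext => n; rewrite /m /tmean /= EFin_Rintegral//; exact: bounded_mfun_min.
  by apply: cvg_EFin; [exact: nearW|exact: cm].
rewrite E /=; apply/cvgrPdist_le => e e0.
have /cvgrPdist_le/(_ _ e0) near_n := cm.
have [N hN] := @filter_ex _ \oo _ _ near_n.
near=> t.
have Nt : N%:R <= t by near: t; apply: nbhs_pinfty_ge; exact: num_real.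
have h1 := tmean_nd P mX X00 Nt.
have h2 : tmean P (X 0%N) t <= limn m.
  apply: (@le_trans _ _ (m (Num.truncn `|t|).+1)).
    by apply: (tmean_nd P mX X00); rewrite (le_trans (ler_norm _))// ltW// truncnS_gt.
  exact: nondecreasing_cvgn_le.
have h3 : m N <= limn m by exact: nondecreasing_cvgn_le.
move: hN; rewrite !ger0_norm ?subr_ge0// => hN; rewrite (le_trans _ hN)//.
by rewrite lerD2l lerN2.
Unshelve. all: by end_near. Qed.

(** The truncated expectation is E min(X, t) - t F(t), which tends to mu. For A = t^alpha mu / c the
    product A F(t) tends to mu as well, so the mean ratio tends to 1. *)
Lemma supercritical_limit : 1 < alpha ->
  cvg_in_law (fun t => normalized_sum X t (t `^ alpha * c^-1 * fine 'E_P[X 0%N]))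
    (exponential_law1 R).
Proof.
move=> a1; have Emu := expectation_tmean a1.
set mu := fine 'E_P[X 0%N] in Emu *.
have a10 : 0 < alpha - 1 by rewrite subr_gt0.
(* Here mu is at least E min(X, 1), which is at least F(1). *)
have mu0 : 0 < mu.
  apply: (@lt_le_trans _ _ (tmean P (X 0%N) 1)).
    have [h _] := @tmean_increment _ _ _ P _ mX X00 0 1 ler01.
    have t0 : 0 <= tmean P (X 0%N) 0.
      by apply: Rintegral_ge0 => w _; rewrite le_min X00 lexx.
    by have := F_gt0 1; move: h; rewrite subr0 mulr1; lra.
  rewrite -(cvg_lim (@Rhausdorff R) Emu); apply: limr_ge.
    by apply/cvg_ex; eexists; exact: Emu.
  near=> t; apply: (tmean_nd P mX X00); near: t; apply: nbhs_pinfty_ge; exact: num_real.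
apply: exponential_limit.
- by near=> t; rewrite !mulr_gt0 ?invr_gt0 ?powR_gt0.
- have pV : (u `^ (alpha - 1))^-1 @[u --> +oo] --> (0 : R).
    apply/gtr0_cvgV0; last exact: cvg_powR_pinfty.
    by near=> u; rewrite powR_gt0//; near: u; apply: nbhs_pinfty_gt; exact: num_real.
  have : (c / mu) * (u `^ (alpha - 1))^-1 @[u --> +oo] --> (c / mu) * (0 : R) by exact: cvgMr.
  rewrite mulr0; apply: cvg_trans; apply: near_eq_cvg; near=> t.
  have t0 : 0 < t by near: t; apply: nbhs_pinfty_gt; exact: num_real.
  have -> : t `^ (alpha - 1) = t `^ alpha / t.
    by rewrite powRB ?powRr1 ?(ltW t0)// gt_eqF ?implybT.
  have p0 : 0 < t `^ alpha by rewrite powR_gt0.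
  by field; rewrite !gt_eqF.
have tF := tail_mul_cvg0 c_gt0 tail_power a1.
have mu_n0 : mu * 1 != 0 by rewrite mulr1 gt_eqF.
have : (tmean P (X 0%N) t - t * F t) / (mu * (F t / (c * t `^ (- alpha)))) @[t --> +oo] -->
    (mu - 0) / (mu * 1).
  apply: cvgM; first exact: cvgB.
  by apply: cvgV => //; exact: cvgMr.
rewrite subr0 mulr1 divff ?gt_eqF//; apply: cvg_trans; apply: near_eq_cvg; near=> t.
have t0 : 0 < t by near: t; apply: nbhs_pinfty_gt; exact: num_real.
rewrite /mean_ratio (tmean_trunc P mX X00 (ltW t0)) powRN.
have p0 : 0 < t `^ alpha by rewrite powR_gt0.
have Ft := F_gt0 t.
by field; rewrite !gt_eqF.
Unshelve. all: by end_near. Qed.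

End passage_laplace.

(** * The Darling--Mandelbrot limit *)

From mathcomp Require Import complex.

Lemma cvg_series_drop0 (R : realType) (c : nat -> R) (l : R) : c 0%N = 1 ->
  series c @ \oo --> l ->
  series (fun n => if n == 0%N then 0 else - c n) @ \oo --> 1 - l.
Proof.
move=> c0 cl; have : (fun N => 1 - series c N) @ \oo --> 1 - l.
  by apply: cvgB => //; exact: cvg_cst.
apply: cvg_trans; apply: near_eq_cvg; near=> N.
have N0 : (0 < N)%N by near: N; exact: nbhs_infty_gt.
rewrite /series/= !(big_ltn N0)/= c0 add0r opprD addrA subrr add0r -sumrN.
by apply: eq_big_nat => n /andP[n0 _]; rewrite gtn_eqF.
Unshelve. all: by end_near. Qed.

(** * Complex sequences and powers of i *)

Section complex_series.
Context (R : realType).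
Local Open Scope complex_scope.

Lemma cvg_complex (x y : nat -> R) (a b : R) :
  x @ \oo --> a -> y @ \oo --> b ->
  (fun N => x N +i* y N : R[i]^o) @ \oo --> (a +i* b : R[i]^o).
Proof.
move=> xa yb; apply/cvgrPdist_lt => e e0.
(* Positivity in R[i] forces [e] to be real. *)
have [r r0 er] : exists2 r : R, 0 < r & e = r%:C.
  exists (complex.Re e); first by move: e0; rewrite ltcE/= => /andP[].
  by rewrite RRe_real// gtr0_real.
have r20 : 0 < r / 2 by rewrite divr_gt0.
have /cvgrPdist_lt/(_ _ r20) hx := xa.
have /cvgrPdist_lt/(_ _ r20) hy := yb.
near=> N.
rewrite er (_ : _ - _ = (a - x N) +i* (b - y N))//.
rewrite normc_def/= ltcR (@le_lt_trans _ _ (`|a - x N| + `|b - y N|))//.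
  rewrite -[leRHS]ger0_norm ?addr_ge0// -sqrtr_sqr ler_sqrt ?sqr_ge0//.
  by rewrite [leRHS]sqrrD !real_normK ?num_real// addrAC lerDl mulrn_wge0// mulr_ge0.
by rewrite (splitr r) ltrD//; near: N.
Unshelve. all: by end_near. Qed.

Lemma expr_i (n : nat) : ('i : R[i]) ^+ n =
  ((~~ odd n)%:R * (-1) ^+ n./2) +i* ((odd n)%:R * (-1) ^+ n.-1./2).
Proof.
elim: n => [|n IH]; first by rewrite /= expr0 !mul1r mul0r.
rewrite exprS IH; case: n {IH} => [|n]; first by rewrite /= !mul0r !mul1r; simpc.
rewrite /= negbK; case: (odd n) => /=; simpc; rewrite ?mul0r ?mul1r ?oppr0//.
by rewrite exprS mulN1r.
Qed.

Lemma exp_i_coeff (s : R) (n : nat) :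
  ('i * s%:C) ^+ n / n`!%:R = (cos_coeff s n) +i* (sin_coeff s n) :> R[i].
Proof.
rewrite exprMn expr_i -rmorphXn/= -(rmorph_nat (real_complex R)) -fmorphV/=.
apply/eqP; rewrite eq_complex/=; apply/andP; split; apply/eqP;
  by rewrite /cos_coeff /sin_coeff/= -?exprnP; ring.
Qed.

End complex_series.

Section darling_mandelbrot.
Context (R : realType) (d : measure_display) (T : measurableType d)
  (P : probability T R) (X : nat -> {RV P >-> R}).
Hypothesis X_indep : mutually_independent X.
Hypothesis X_ident : identically_distributed X.
Hypothesis X_ge0 : forall i w, 0 <= X i w.

Notation Y := (sum_before_passage X).
Notation F := (tail P (X 0%N)).

Hypothesis F_gt0 : forall t, 0 < F t.
Context (c alpha : R).
Hypothesis c_gt0 : 0 < c.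
Hypothesis alpha_gt0 : 0 < alpha.
Hypothesis alpha_lt1 : alpha < 1.
Hypothesis tail_power : F x / (c * x `^ (- alpha)) @[x --> +oo] --> (1 : R).

Let mX : measurable_fun setT (X 0%N : T -> R). Proof. by []. Qed.
Let X00 w : 0 <= X 0%N w. Proof. by []. Qed.

Let kappa (n : nat) : R := alpha / (n%:R - alpha).

Let moment_ratio n : (0 < n)%N ->
  truncated_moment P (X 0%N) n t / (t ^+ n * F t) @[t --> +oo] --> kappa n.
Proof. by move=> n0; exact: (truncated_moment_ratio mX X00 c_gt0 alpha_gt0
  tail_power n0 alpha_lt1). Qed.

Let exp_coeff_norm (s : R) n : `|s ^+ n / n`!%:R| = exp_coeff `|s| n.
Proof. by rewrite /exp_coeff/= normrM normfV normr_nat normrX. Qed.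

(** Existence of the limit is what the construction of the law asks for; the law is identified
    afterwards by its characteristic function. *)
Lemma laplace_ratio_cvg (l : R) : 0 <= l -> cvg (laplace_ratio X l t t @[t --> +oo]).
Proof.
move=> l0.
pose a n := if n == 0%N then 0 else - exp_coeff (- l) n.
have [|||||_ H] := @series_ratio R _ T P _ mX X00 F_gt0 kappa moment_ratio
    (fun y => 1 - expR (- (l * y))) a (exp_coeff `|- l|).
- by apply: measurable_funB; [exact: measurable_cst|exact: measurable_expRN].
- by [].
- move=> n; rewrite /a; case: ifP => _; first by rewrite normr0 exp_coeff_ge0.
  by rewrite normrN -exp_coeff_norm.
- exact: is_cvg_series_exp_coeff.
- move=> y y01.
  have := @cvg_series_drop0 R (exp_coeff (- (l * y))) (expR (- (l * y))).
  rewrite (_ : (fun n => if _ then _ else _) = fun n => a n * y ^+ n); last first.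
    apply/funext => -[|n]; rewrite /a /exp_coeff/= ?mul0r//.
    by rewrite -[- (l * y)]mulNr exprMn; ring.
  apply; first by rewrite /exp_coeff/= expr0 divr1.
  exact: is_cvg_series_exp_coeff.
by apply/cvg_ex; eexists; exact: H.
Qed.

Let cos_series (s : R) : let a n := if n == 0%N then 0 else - cos_coeff s n in
  cvgn (series (fun n => a n * kappa n)) /\
  (\int[P]_w ((1 - cos (s * (X 0%N w / t))) * \1_`[0, t[ (X 0%N w))) / F t @[t --> +oo] -->
    limn (series (fun n => a n * kappa n)).
Proof.
move=> a.
apply: (@series_ratio R _ T P _ mX X00 F_gt0 kappa moment_ratio
    (fun y => 1 - cos (s * y)) a (exp_coeff `|s|)).
- apply: measurable_funB; first exact: measurable_cst.
  apply: continuous_measurable_fun => x; apply: continuous_comp; last exact: continuous_cos.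
  by apply: cvgMl_tmp; exact: cvg_id.
- by [].
- move=> n; rewrite /a; case: ifP => _; first by rewrite normr0 exp_coeff_ge0.
  rewrite normrN -exp_coeff_norm /cos_coeff/= -?exprnP -mulrA normrM ler_piMl//.
  by rewrite normrM normr_nat normrX normrN normr1 expr1n mulr1 lern1 leq_b1.
- exact: is_cvg_series_exp_coeff.
- move=> y y01.
  have := @cvg_series_drop0 R (cos_coeff (s * y)) (cos (s * y)).
  rewrite (_ : (fun n => if _ then _ else _) = fun n => a n * y ^+ n); last first.
    apply/funext => -[|n]; rewrite /a /cos_coeff/= ?mul0r//.
    by rewrite exprMn; ring.
  apply; first by rewrite /cos_coeff/= divr1 2!mul1r ?expr0.
  by rewrite unlock; exact: is_cvg_series_cos_coeff.
Qed.

Let sin_series (s : R) :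
  cvgn (series (fun n => sin_coeff s n * kappa n)) /\
  (\int[P]_w (sin (s * (X 0%N w / t)) * \1_`[0, t[ (X 0%N w))) / F t @[t --> +oo] -->
    limn (series (fun n => sin_coeff s n * kappa n)).
Proof.
apply: (@series_ratio R _ T P _ mX X00 F_gt0 kappa moment_ratio
    (fun y => sin (s * y)) (sin_coeff s) (exp_coeff `|s|)).
- apply: continuous_measurable_fun => x; apply: continuous_comp; last exact: continuous_sin.
  by apply: cvgMl_tmp; exact: cvg_id.
- by rewrite /sin_coeff/= !mul0r.
- move=> n; rewrite -exp_coeff_norm /sin_coeff/= -mulrA normrM ler_piMl//.
  by rewrite normrM normr_nat normrX normrN normr1 expr1n mulr1 lern1 leq_b1.
- exact: is_cvg_series_exp_coeff.
- move=> y y01; rewrite (_ : (fun n => _) = sin_coeff (s * y)).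
    by rewrite unlock; exact: is_cvg_series_sin_coeff.
  by apply/funext => n; rewrite /sin_coeff/= exprMn; ring.
Qed.

Let passage_trig (s t : R) : 0 < t ->
  let u := \int[P]_w cos (s * (Y t w / t)) in let v := \int[P]_w sin (s * (Y t w / t)) in
  let ra := (\int[P]_w ((1 - cos (s * (X 0%N w / t))) * \1_`[0, t[ (X 0%N w))) / F t in
  let rb := (\int[P]_w (sin (s * (X 0%N w / t)) * \1_`[0, t[ (X 0%N w))) / F t in
  u * (1 + ra) + v * rb = 1 /\ v * (1 + ra) - u * rb = 0.
Proof.
move=> t0.
apply: (passage_ratio X_indep X_ident X_ge0
  (a := fun x => cos (s * (x / t))) (b := fun x => sin (s * (x / t)))) => //.
- apply: continuous_measurable_fun => x; apply: continuous_comp; last exact: continuous_cos.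
  by apply: cvgMl_tmp; apply: cvgMr_tmp; exact: cvg_id.
- apply: continuous_measurable_fun => x; apply: continuous_comp; last exact: continuous_sin.
  by apply: cvgMl_tmp; apply: cvgMr_tmp; exact: cvg_id.
- by move=> x _; exact: cos_max.
- by move=> x _; exact: sin_max.
- by rewrite mul0r mulr0 cos0.
- by rewrite mul0r mulr0 sin0.
- by move=> x y _ _; rewrite mulrDl mulrDr cosD.
- by move=> x y _ _; rewrite mulrDl mulrDr sinD addrC.
Qed.

Local Open Scope complex_scope.

Lemma darling_mandelbrot_limit : exists nu : probability (measurableTypeR R) R,
  darling_mandelbrot_law alpha nu /\
  cvg_in_law (fun t => normalized_sum X t t) nu.
Proof.
have t_gt0 : \forall t \near +oo, (0 : R) < t by apply: nbhs_pinfty_gt; exact: num_real.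
(* The mean of Y_t / t is the first moment ratio, which gives tightness with the constant
   [kappa 1 + 1]. *)
have M1 : mean_ratio X t t @[t --> +oo] --> kappa 1.
  have := moment_ratio (ltn0Sn 0); apply: cvg_trans; apply: near_eq_cvg; near=> t.
  by rewrite /truncated_moment /mean_ratio expr1.
have k1 : kappa 1 < kappa 1 + 1 by rewrite ltrDl.
have [||k|nu [nu1 [nulaw nuf]]] :=
    @laplace_limit_exists R _ T P (fun t => normalized_sum X t t) (kappa 1 + 1).
- by near=> t => w; apply: (normalized_sum_ge0 X_ge0); near: t.
- near=> t; apply: (laplace_tight_normalized X_indep X_ident X_ge0) => //; [by near: t..|].
  by apply: ltW; near: t; apply: (cvgr_lt _ M1).
- have cr := laplace_ratio_cvg (ler0n R k); set L := lim _ in cr.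
  have L0 : 0 <= L.
    apply: limr_ge; first by apply/cvg_ex; exists L; exact: cr.
    by near=> t; apply: (laplace_ratio_ge0 X_ge0) => //; near: t.
  have n0 : 1 + L != 0 by rewrite gt_eqF// ltr_pwDl.
  have : (1 + laplace_ratio X k%:R t t)^-1 @[t --> +oo] --> (1 + L)^-1.
    by apply: cvgV => //; apply: cvgD; [exact: cvg_cst|exact: cr].
  move=> cV; apply/cvg_ex; exists (1 + L)^-1; move: cV.
  apply: cvg_trans; apply: near_eq_cvg; near=> t.
  have t0 : 0 < t by near: t.
  have r0 := laplace_ratio_ge0 X_ge0 (ler0n R k) t0 (F_gt0 t).
  have n0' : 1 + laplace_ratio X k%:R t t != 0 by rewrite gt_eqF// ltr_pwDl.
  apply: (mulIf n0'); rewrite mulVf//.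
  by have := passage_laplace X_indep X_ident X_ge0 (ler0n R k) t0 (F_gt0 t).
exists nu; split => //; split => // s.
pose U := \int[nu]_x cos (s * x); pose V := \int[nu]_x sin (s * x).
have bnd (g : R -> R) : (forall x, `|g x| <= 1) -> bounded_fun (fun x => g (s * x)).
  move=> g1; exists 1; split; first exact: num_real.
  by move=> x x1 y _; rewrite /= (le_trans (g1 _))// ltW.
have cU : \int[P]_w cos (s * (Y t w / t)) @[t --> +oo] --> U.
  apply: (nuf (fun x => cos (s * x))); last by apply: bnd; exact: cos_max.
  move=> x; apply: continuous_comp; last exact: continuous_cos.
  by apply: cvgMl_tmp; exact: cvg_id.
have cV : \int[P]_w sin (s * (Y t w / t)) @[t --> +oo] --> V.
  apply: (nuf (fun x => sin (s * x))); last by apply: bnd; exact: sin_max.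
  move=> x; apply: continuous_comp; last exact: continuous_sin.
  by apply: cvgMl_tmp; exact: cvg_id.
have [] := cos_series s; set Sc := limn _ => cvSc cSc.
have [] := sin_series s; set Ss := limn _ => cvSs cSs.
pose ra t := (\int[P]_w ((1 - cos (s * (X 0%N w / t))) * \1_`[0, t[ (X 0%N w))) / F t.
pose rb t := (\int[P]_w (sin (s * (X 0%N w / t)) * \1_`[0, t[ (X 0%N w))) / F t.
pose u t := \int[P]_w cos (s * (Y t w / t)); pose v t := \int[P]_w sin (s * (Y t w / t)).
have c1 : 1 + ra t @[t --> +oo] --> 1 + Sc by apply: cvgD; [exact: cvg_cst|exact: cSc].
(* [E1] and [E2] are the real and imaginary parts of (U + i V) z = 1 for z = 1 + Sc - i Ss, read off
   from functions of t that are eventually constant. *)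
have E1 : U * (1 + Sc) + V * Ss = 1.
  have h : u t * (1 + ra t) + v t * rb t @[t --> +oo] --> U * (1 + Sc) + V * Ss.
    by apply: cvgD; apply: cvgM.
  rewrite -(cvg_lim (@Rhausdorff R) h); apply: cvg_lim; first exact: Rhausdorff.
  apply: cvg_near_cst; near=> t.
  by have [] := @passage_trig s t; first by near: t.
have E2 : V * (1 + Sc) - U * Ss = 0.
  have h : v t * (1 + ra t) - u t * rb t @[t --> +oo] --> V * (1 + Sc) - U * Ss.
    by apply: cvgB; apply: cvgM.
  rewrite -(cvg_lim (@Rhausdorff R) h); apply: cvg_lim; first exact: Rhausdorff.
  apply: cvg_near_cst; near=> t.
  by have [] := @passage_trig s t; first by near: t.
rewrite /charfun -/U -/V /darling_mandelbrot_charfun.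
have -> : (fun N : nat => \sum_(1 <= n < N)
     (alpha / (n%:R - alpha))%:C * ('i * s%:C) ^+ n / n`!%:R : R[i]^o) =
  (fun N => (- series (fun n => (if n == 0%N then 0 else - cos_coeff s n) * kappa n) N)
     +i* series (fun n => sin_coeff s n * kappa n) N : R[i]^o).
  apply/funext => N.
  have -> : series (fun n => (if n == 0%N then 0 else - cos_coeff s n) * kappa n) N =
      - \sum_(1 <= n < N) cos_coeff s n * kappa n.
    case: N => [|N]; first by rewrite /series/= !big_geq// oppr0.
    rewrite /series/= big_ltn// mul0r add0r -sumrN; apply: eq_big_nat => n /andP[n0 _].
    by rewrite gtn_eqF// mulNr.
  have -> : series (fun n => sin_coeff s n * kappa n) N =
      \sum_(1 <= n < N) sin_coeff s n * kappa n.
    case: N => [|N]; first by rewrite /series/= !big_geq.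
    by rewrite /series/= big_ltn// /sin_coeff/= !mul0r add0r.
  rewrite opprK; elim: N => [|N IH]; first by rewrite !big_geq.
  case: N IH => [|N] IH; first by rewrite !big_geq.
  rewrite !(big_nat_recr N.+1)//= IH -mulrA exp_i_coeff.
  by simpc; rewrite ![kappa _ * _]mulrC.
have cN : (fun N => - series (fun n => (if n == 0%N then 0 else - cos_coeff s n) * kappa n) N)
    @ \oo --> - Sc by apply: cvgN; exact: cvSc.
rewrite (cvg_lim (@norm_hausdorff _ _) (cvg_complex cN cvSs)).
set z := 1 - _.
have UVz : (U +i* V) * z = 1.
  rewrite /z; simpc; apply/eqP; rewrite eq_complex/=; apply/andP; split; apply/eqP.
    exact: E1.
  by rewrite addrC; exact: E2.
(* The denominator cannot vanish, since its product with the characteristic function is 1. *)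
have z0 : z != 0.
  by apply/eqP => z0; move: UVz; rewrite z0 mulr0 => /esym/eqP; rewrite oner_eq0.
by apply: (mulIf z0); rewrite UVz mulVf.
Unshelve. all: by end_near. Qed.

End darling_mandelbrot.

(** * Conclusion *)

Lemma upper_tailE (R : realType) (d : measure_display) (T : measurableType d)
    (P : probability T R) (X : {RV P >-> R}) (x : R) :
  upper_tail X x = tail P X x.
Proof.
rewrite /tail (_ : \int[P]_w _ = fine (P (X @^-1` `[x, +oo[)))//.
rewrite -Pint_indic//.
by rewrite -[X in measurable X]setTI; exact: (measurable_funPT X).
Qed.

Theorem theorem1 (R : realType) (d : measure_display) (T : measurableType d)
    (P : probability T R) (X : nat -> {RV P >-> R}) (c alpha : R)
    (X_indep : mutually_independent X)
    (X_ident : identically_distributed X)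
    (X_ge0 : forall i w, 0 <= X i w)
    (X_unbounded : forall x, 0 < upper_tail (X 0%N) x)
    (c_gt0 : 0 < c) (alpha_gt0 : 0 < alpha)
    (X_tail : upper_tail (X 0%N) x / (c * x `^ (- alpha)) @[x --> +oo]
                --> (1 : R)) :
  (alpha < 1 ->
    exists nu : probability (measurableTypeR R) R, darling_mandelbrot_law alpha nu /\
      cvg_in_law (fun t => normalized_sum X t t) nu) /\
  (alpha = 1 ->
    cvg_in_law (fun t => normalized_sum X t (t * ln t)) (exponential_law1 R)) /\
  (1 < alpha ->
    cvg_in_law
      (fun t => normalized_sum X t
         (t `^ alpha * c^-1 * fine 'E_P[X 0%N]))
      (exponential_law1 R)).
Proof.
have F_gt0 t : 0 < tail P (X 0%N) t by rewrite -upper_tailE.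
have tail_power : tail P (X 0%N) x / (c * x `^ (- alpha)) @[x --> +oo] --> (1 : R).
  by under eq_fun do rewrite -upper_tailE.
split; last split.
- by move=> alpha_lt1; exact: darling_mandelbrot_limit tail_power.
- by move=> alpha1; exact: critical_limit tail_power alpha1.
- by move=> alpha_gt1; exact: supercritical_limit tail_power alpha_gt1.
Qed.
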